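(* Let $\tilde w=s_{\beta_1}\cdots s_{\beta_r}$ be an expression (not necessarily reduced) in simple reflections of the Weyl group of a Kac-Moody group $G$, and let $Y_{\tilde w}$ be the toric limit of the Bott-Samelson-Demazure-Hansen variety $Z(\tilde w)$. (1) If $\tilde w$ satisfies condition $I$, then $Y_{\tilde w}$ is Fano. (2) If $\tilde w$ satisfies condition $II$, then $Y_{\tilde w}$ is weak Fano.
   Context: We work over $\mathbb C$. $G$ is the Kac-Moody group of a generalized Cartan matrix, with maximal torus $T$, Borel subgroup $B\supset T$, simple roots $S$, minimal parabolic subgroups $P_\alpha$ ($\alpha\in S$). An expression is a finite sequence $\tilde w=s_{\beta_1}\cdots s_{\beta_r}$ of simple reflections, $\beta_i\in S$. Put $\beta_{ij}:=\langle\beta_j,\check\beta_i\rangle$, where $\check\beta_i$ is the coroot of $\beta_i$. $Z(\tilde w)=P_{\beta_1}\times\cdots\times P_{\beta_r}/B^r$ with action $(p_1,\dots,p_r)\cdot(b_1,\dots,b_r)=(p_1b_1,b_1^{-1}p_2b_2,\dots,b_{r-1}^{-1}p_rb_r)$. Toric limit: choose an injective one-parameter subgroup $\lambda:\mathbb G_m\to T$ and $q>0$ with $\alpha(\lambda(u))=u^q$ for all $\alpha\in S$; let $\Psi_u(b)=\lambda(u)b\lambda(u)^{-1}$ for $u\ne0$, $b\in B$, extended to $u=0$ by the projection $\Psi_0:B\to T$. Let $\mathcal X=\mathbb A^1\times P_{\beta_1}\times\cdots\times P_{\beta_r}/B^r$ with action $(u,p_1,\dots,p_r)\cdot(b_1,\dots,b_r)=(u,p_1b_1,\Psi_u(b_1)^{-1}p_2b_2,\dots,\Psi_u(b_{r-1})^{-1}p_rb_r)$.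 The projection $\mathcal X\to\mathbb A^1$ is smooth projective with fibres over $u\neq0$ isomorphic to $Z(\tilde w)$; $Y_{\tilde w}$ is the fibre over $0$. It is the smooth projective toric variety whose fan in $\mathbb R^r$ is as follows (known): with $e_1^+,\dots,e_r^+$ the standard basis of $\mathbb Z^r$ and $e_i^-:=-e_i^+-\sum_{j>i}\beta_{ij}e_j^+$, the cones are those generated by subsets of $\{e_1^{\pm},\dots,e_r^{\pm}\}$ containing no pair $\{e_i^+,e_i^-\}$. Conditions: for $1\le i\le r$ let $\eta_i^+=\{j: i<j\le r,\ \beta_{ij}>0\}$, $\eta_i^-=\{j: i<j\le r,\ \beta_{ij}<0\}$. - $N_i^1$: $|\eta_i^+|=0$, $|\eta_i^-|\le1$, and if $\eta_i^-=\{l\}$ then $\beta_{il}=-1$. - $N_i^2$: $|\eta_i^+|=0$, $|\eta_i^-|\le2$; if $\eta_i^-=\{l\}$ then $\beta_{il}\in\{-1,-2\}$; if $\eta_i^-=\{l_1,l_2\}$ (two elements) then $\beta_{il_1}=\beta_{il_2}=-1$. $\tilde w$ satisfies condition $I$ (resp. $II$) if $N_i^1$ (resp. $N_i^2$) holds for all $1\le i\le r$. A smooth projective variety $X$ is Fano (resp. weak Fano) if $-K_X$ is ample (resp. nef and big). *)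

(* Defs.v *)
(* MathComp, with the classical sets of MathComp-Analysis. *)
From mathcomp Require Import all_boot all_order all_algebra.
From mathcomp Require Import complex.
From mathcomp Require mpoly.
From mathcomp Require Import boolp classical_sets functions fsbigop reals.

Set Implicit Arguments.
Unset Strict Implicit.
Unset Printing Implicit Defensive.

Import Order.TTheory GRing.Theory Num.Theory.
Local Open Scope classical_set_scope.
Local Open Scope ring_scope.

(** * Varieties as spaces with functions

   Varieties over an algebraically closed field K are handled through their
   closed points, as spaces with functions: a set of points, its Zariski open
   sets, and for every open V the K-valued functions regular on V.  A regular
   function on V is represented by a function on the whole space whose values
   outside V are irrelevant. *)

Record space (K : Type) := Space {
  pt :> Type;
  sopen : set (set pt);
  sreg : set pt -> set (pt -> K) }.

Definition sclosed (K : Type) (X : space K) (Z : set X) : Prop := sopen (~` Z).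

Definition morphism (K : Type) (X Y : space K) (f : X -> Y) : Prop :=
  (forall V : set Y, sopen V -> sopen (f @^-1` V)) /\
  (forall (V : set Y) (h : Y -> K), sopen V -> sreg V h ->
     sreg (f @^-1` V) (h \o f)).

Definition isomorphic (K : Type) (X Y : space K) : Prop :=
  exists (f : X -> Y) (g : Y -> X),
    [/\ cancel f g, cancel g f, morphism f & morphism g].

(* The structure induced on a subset Z (open, or closed and reduced): regular
   functions are locally restrictions of regular functions of X. *)
Definition subspace (K : Type) (X : space K) (Z : set X) : space K :=
  @Space K {x : X | Z x}
    [set W | exists2 V : set X, sopen V & W = [set z | V (sval z)]]
    (fun W => [set f | forall p, W p ->
       exists (V : set X) (g : X -> K),
         [/\ sopen V, sreg V g, V (sval p)
           & forall q, W q -> V (sval q) -> f q = g (sval q)]]).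

(* The space with functions attached to a K-algebra A of functions on T: the
   sets g <> 0, for g in A, are a basis of open sets, and the regular functions
   are locally of the form a / g with a, g in A. *)
Definition alg_space (K : fieldType) (T : Type) (A : set (T -> K)) : space K :=
  @Space K T
    [set V | forall p, V p ->
       exists g, [/\ A g, g p != 0 & forall q, g q != 0 -> V q]]
    (fun V => [set f | forall p, V p ->
       exists a g, [/\ A a, A g, g p != 0
         & forall q, V q -> g q != 0 -> f q = a q / g q]]).

Definition affine_space (K : fieldType) (N : nat) : space K :=
  @alg_space K 'rV[K]_N
    [set f | exists P : mpoly.mpoly N K,
       f = fun x : 'rV[K]_N => mpoly.meval (fun i => x ord0 i) P].

Definition affine (K : fieldType) (X : space K) : Prop :=
  exists (N : nat) (Z : set (affine_space K N)),
    sclosed Z /\ isomorphic X (subspace Z).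

Definition irreducible (K : Type) (X : space K) (Z : set X) : Prop :=
  Z !=set0 /\
  forall Z1 Z2 : set X, sclosed Z1 -> sclosed Z2 ->
    Z `<=` Z1 `|` Z2 -> Z `<=` Z1 \/ Z `<=` Z2.

(* Irreducible closed subsets of Krull dimension 1. *)
Definition curve (K : Type) (X : space K) (Z : set X) : Prop :=
  [/\ sclosed Z, irreducible Z, (forall p, Z <> [set p])
    & forall W : set X, sclosed W -> irreducible W -> W `<=` Z -> W <> Z ->
        exists p, W = [set p]].

(** * Local rings *)

(* f represents an element of the local ring O_p. *)
Definition germ (K : Type) (X : space K) (p : X) (f : X -> K) : Prop :=
  exists V : set X, [/\ sopen V, V p & sreg V f].

(* f represents an element of the square of the maximal ideal of O_p. *)
Definition in_sqmax (K : fieldType) (X : space K) (p : X) (f : X -> K) : Prop :=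
  exists (V : set X) (N : nat) (a b : 'I_N -> X -> K),
    [/\ sopen V, V p,
        (forall i, [/\ sreg V (a i), sreg V (b i), a i p = 0 & b i p = 0])
      & forall q, V q -> f q = \sum_(i < N) a i q * b i q].

(* df = sum_j c_j dphi_j in the cotangent space m_p / m_p^2. *)
Definition differential_at (K : fieldType) (X : space K) (n : nat)
    (phi : 'I_n -> X -> K) (p : X) (f : X -> K) (c : 'I_n -> K) : Prop :=
  in_sqmax p
    (fun q => f q - f p - \sum_(j < n) c j * (phi j q - phi j p)).

(* The K-vector space O_p / (a) has dimension d. *)
Definition has_colength (K : fieldType) (X : space K) (p : X) (a : X -> K)
    (d : nat) : Prop :=
  exists e : 'I_d -> X -> K,
    (forall i, germ p (e i)) /\
    forall f, germ p f -> exists! c : 'rV[K]_d,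
      exists (g : X -> K) (V : set X),
        [/\ germ p g, sopen V, V p
          & forall q, V q ->
              f q = \sum_(i < d) c ord0 i * e i q + a q * g q].

(* Only meaningful when O_p / (a) is finite dimensional, e.g. when a is a
   nonzero element of the local ring of a curve. *)
Definition colength (K : fieldType) (X : space K) (p : X) (a : X -> K) : nat :=
  xget 0%N [set d | has_colength p a d].

(** * Line bundles

   A line bundle is given by a family of local frames e_t, on open sets covering
   the space, and by its transition functions: a section which is s_t e_t on the
   domain of e_t satisfies s_t = (trans t t') s_t' on common domains. *)

Record line_bundle (K : Type) (X : space K) := LineBundle {
  frame : Type;
  fdom : frame -> set X;
  trans : frame -> frame -> X -> K }.

Definition lb_dual (K : fieldType) (X : space K) (L : line_bundle X) :
    line_bundle X :=
  LineBundle (@fdom K X L) (fun t t' p => (trans t t' p)^-1).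

Definition lb_pow (K : fieldType) (X : space K) (L : line_bundle X) (k : nat) :
    line_bundle X :=
  LineBundle (@fdom K X L) (fun t t' p => trans t t' p ^+ k).

Definition lb_restr (K : fieldType) (X : space K) (L : line_bundle X)
    (Z : set X) : line_bundle (subspace Z) :=
  @LineBundle K (subspace Z) (frame L)
    (fun t => [set z | fdom t (sval z)])
    (fun t t' z => trans t t' (sval z)).

(* Sections over an open set U, given by their coordinates in all frames. *)
Definition is_section (K : fieldType) (X : space K) (L : line_bundle X)
    (U : set X) (s : frame L -> X -> K) : Prop :=
  (forall t, sreg (U `&` fdom t) (s t)) /\
  (forall t t' p, U p -> fdom t p -> fdom t' p ->
     s t p = trans t t' p * s t' p).

(* The open set X_s where s does not vanish. *)
Definition nonvanishing (K : fieldType) (X : space K) (L : line_bundle X)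
    (s : frame L -> X -> K) : set X :=
  [set p | exists2 t, fdom t p & s t p != 0].

Definition ample (K : fieldType) (X : space K) (L : line_bundle X) : Prop :=
  forall p : X, exists (k : nat) (s : frame (lb_pow L k) -> X -> K),
    [/\ (0 < k)%N, is_section setT s, nonvanishing s p
      & affine (subspace (nonvanishing s))].

(* m is the order at p of the rational section s, which is defined over the
   nonempty open set W of an integral curve: s_t = a / b with a, b in O_p,
   b <> 0, and m = dim O_p / (a) - dim O_p / (b). *)
Definition section_order (K : fieldType) (Y : space K) (L : line_bundle Y)
    (W : set Y) (s : frame L -> Y -> K) (p : Y) (m : int) : Prop :=
  exists (t : frame L) (V : set Y) (a b : Y -> K),
    [/\ fdom t p, sopen V /\ V p, sreg V a /\ sreg V b,
        (exists2 q, V q & b q != 0)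
      & (forall q, V q -> W q -> fdom t q -> s t q * b q = a q) /\
        m = (colength p a)%:Z - (colength p b)%:Z].

(* d is the degree of L on an integral complete curve Y, i.e. the sum of the
   orders of a nonzero rational section.  Only finitely many orders are nonzero,
   and d does not depend on the section. *)
Definition has_degree (K : fieldType) (Y : space K) (L : line_bundle Y)
    (d : int) : Prop :=
  exists (W : set Y) (s : frame L -> Y -> K) (m : Y -> int),
    [/\ sopen W, is_section W s, (exists2 q, W q & nonvanishing s q),
        (forall p, section_order W s p (m p))
      & d = \sum_(p \in [set: {classic Y}]) m p].

(* For X complete, so that its closed curves are complete. *)
Definition nef (K : fieldType) (X : space K) (L : line_bundle X) : Prop :=
  forall Z : set X, curve Z ->
    exists d : int, has_degree (lb_restr L Z) d /\ 0 <= d.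

(* The space of global sections of L has dimension at least N. *)
Definition h0_geq (K : fieldType) (X : space K) (L : line_bundle X) (N : nat) :
    Prop :=
  exists s : 'I_N -> frame L -> X -> K,
    (forall i, is_section setT (s i)) /\
    forall c : 'I_N -> K,
      (forall t p, fdom t p -> \sum_(i < N) c i * s i t p = 0) ->
      forall i, c i = 0.

(* h^0(X, L^k) >= c k^n for some c > 0 and all k >> 0, where n = dim X. *)
Definition big (K : fieldType) (X : space K) (n : nat) (L : line_bundle X) :
    Prop :=
  exists (c : rat) (k0 : nat), 0 < c /\
    forall k : nat, (k0 <= k)%N ->
      exists N : nat, h0_geq (lb_pow L k) N /\ c * k%:R ^+ n <= N%:R.

(** * The canonical bundle of a smooth variety of dimension n *)

(* Local (etale) coordinates: regular functions whose differentials are a basis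
   of every cotangent space. *)
Record coords (K : fieldType) (X : space K) (n : nat) := Coords {
  cdom : set X;
  cfun : 'I_n -> X -> K;
  cdom_open : sopen cdom;
  cfun_reg : forall i, sreg cdom (cfun i);
  cfun_basis : forall p, cdom p -> forall f, germ p f ->
    exists! c : 'rV[K]_n, differential_at cfun p f (c ord0) }.

Definition smooth (K : fieldType) (X : space K) (n : nat) : Prop :=
  forall p : X, exists x : coords X n, cdom x p.

(* The Jacobian matrix (d x_i / d y_j) at p. *)
Definition jacobian (K : fieldType) (X : space K) (n : nat) (x y : coords X n)
    (p : X) : 'M[K]_n :=
  xget 0 [set J : 'M[K]_n |
    forall i, differential_at (cfun y) p (cfun x i) (J i)].

(* The frame attached to x is dx_1 /\ ... /\ dx_n, and
   dy_1 /\ ... /\ dy_n = det (dy/dx) dx_1 /\ ... /\ dx_n. *)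
Definition canonical_bundle (K : fieldType) (X : space K) (n : nat) :
    line_bundle X :=
  @LineBundle K X (coords X n) (@cdom K X n)
    (fun x y p => \det (jacobian y x p)).

Definition anticanonical_bundle (K : fieldType) (X : space K) (n : nat) :
    line_bundle X := lb_dual (canonical_bundle X n).

(* The next two are predicates on complete varieties of dimension n. *)
Definition fano (K : fieldType) (X : space K) (n : nat) : Prop :=
  smooth X n /\ ample (anticanonical_bundle X n).

Definition weak_fano (K : fieldType) (X : space K) (n : nat) : Prop :=
  [/\ smooth X n, nef (anticanonical_bundle X n)
    & big n (anticanonical_bundle X n)].

(** * The toric variety of a simplicial fan

   The lattice N of the fan and its dual M are both 'rV[int]_n.  A cone is
   represented by the set of indices of its rays; the intersection of two cones
   of a simplicial fan is then the intersection of index sets. *)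

Record fan (n : nat) := Fan {
  ray_idx : finType;
  ray : ray_idx -> 'rV[int]_n;
  cones : {set {set ray_idx}} }.

Definition pairing (n : nat) (m v : 'rV[int]_n) : int :=
  \sum_(i < n) m ord0 i * v ord0 i.

(* The lattice points of the dual cone of sigma. *)
Definition dual_cone (n : nat) (F : fan n) (sigma : {set ray_idx F}) :
    set 'rV[int]_n :=
  [set m | forall i, i \in sigma -> 0 <= pairing m (ray i)].

(* g restricts to a morphism from the dual cone to the monoid K; its values
   elsewhere are irrelevant. *)
Definition is_character (K : fieldType) (n : nat) (F : fan n)
    (sigma : {set ray_idx F}) (g : 'rV[int]_n -> K) : Prop :=
  g 0 = 1 /\
  forall m m', dual_cone sigma m -> dual_cone sigma m' ->
    g (m + m') = g m * g m'.

(* The affine toric variety of sigma: the closed points of the spectrum of the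
   monoid algebra of the dual cone, with that algebra of functions. *)
Definition toric_chart (K : fieldType) (n : nat) (F : fan n)
    (sigma : {set ray_idx F}) : space K :=
  @alg_space K {g : 'rV[int]_n -> K | is_character sigma g}
    [set f | exists (k : nat) (c : 'I_k -> K) (m : 'I_k -> 'rV[int]_n),
       (forall i, dual_cone sigma (m i)) /\
       f = fun g => \sum_(i < k) c i * sval g (m i)].

Definition chart_point (K : fieldType) (n : nat) (F : fan n) : Type :=
  {sigma : {sigma : {set ray_idx F} | sigma \in cones F}
         & toric_chart K (sval sigma)}.

(* Two points of charts are glued when they come from one point of the chart of
   the intersection of the two cones. *)
Definition glued (K : fieldType) (n : nat) (F : fan n)
    (a b : chart_point K F) : Prop :=
  exists g : 'rV[int]_n -> K,
    [/\ is_character (sval (tag a) :&: sval (tag b)) g,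
        (forall m, dual_cone (sval (tag a)) m -> sval (tagged a) m = g m)
      & (forall m, dual_cone (sval (tag b)) m -> sval (tagged b) m = g m)].

Definition toric_point (K : fieldType) (n : nat) (F : fan n) : Type :=
  {P : set (chart_point K F) | exists a, P = [set b | glued a b]}.

Definition chart_incl (K : fieldType) (n : nat) (F : fan n)
    (sigma : {sigma : {set ray_idx F} | sigma \in cones F})
    (g : toric_chart K (sval sigma)) : toric_point K F :=
  let a : chart_point K F := existT _ sigma g in
  exist _ [set b | glued a b] (ex_intro _ a erefl).

Definition toric_variety (K : fieldType) (n : nat) (F : fan n) : space K :=
  @Space K (toric_point K F)
    [set V | forall sigma, sopen (chart_incl (sigma := sigma) @^-1` V)]
    (fun V => [set f : toric_point K F -> K | forall sigma,
       sreg (chart_incl (sigma := sigma) @^-1` V)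
            (f \o chart_incl (sigma := sigma))]).

(** * Expressions and toric limits *)

Definition gen_cartan (S : finType) (A : S -> S -> int) : Prop :=
  [/\ forall a, A a a = 2,
      forall a b, a != b -> A a b <= 0
    & forall a b, A a b = 0 <-> A b a = 0].

(* A a b = <b, a^vee>; an expression is the tuple of its simple roots. *)
Definition beta (S : finType) (A : S -> S -> int) (r : nat) (w : r.-tuple S)
    (i j : 'I_r) : int := A (tnth w i) (tnth w j).

(* (true, i) indexes e_i^+ and (false, i) indexes e_i^-. *)
Definition limit_ray (r : nat) (b : 'I_r -> 'I_r -> int) (x : bool * 'I_r) :
    'rV[int]_r :=
  let e (i : 'I_r) : 'rV[int]_r := delta_mx ord0 i in
  if x.1 then e x.2
  else - e x.2 - \sum_(j < r | (x.2 < j)%N) b x.2 j *: e j.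

Definition limit_fan (r : nat) (b : 'I_r -> 'I_r -> int) : fan r :=
  @Fan r (bool * 'I_r)%type (limit_ray b)
    [set sigma : {set bool * 'I_r} |
       [forall i, ~~ (((true, i) \in sigma) && ((false, i) \in sigma))]]%SET.

Definition toric_limit (K : fieldType) (S : finType) (A : S -> S -> int)
    (r : nat) (w : r.-tuple S) : space K :=
  toric_variety K (limit_fan (beta A w)).

Definition eta_plus (r : nat) (b : 'I_r -> 'I_r -> int) (i : 'I_r) :
    {set 'I_r} := [set j : 'I_r | (i < j)%N && (0 < b i j)]%SET.

Definition eta_minus (r : nat) (b : 'I_r -> 'I_r -> int) (i : 'I_r) :
    {set 'I_r} := [set j : 'I_r | (i < j)%N && (b i j < 0)]%SET.

Definition cond_N1 (r : nat) (b : 'I_r -> 'I_r -> int) (i : 'I_r) : Prop :=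
  [/\ #|eta_plus b i| = 0%N, (#|eta_minus b i| <= 1)%N
    & forall l, eta_minus b i = [set l]%SET -> b i l = -1].

Definition cond_N2 (r : nat) (b : 'I_r -> 'I_r -> int) (i : 'I_r) : Prop :=
  [/\ #|eta_plus b i| = 0%N, (#|eta_minus b i| <= 2)%N,
      forall l, eta_minus b i = [set l]%SET -> b i l = -1 \/ b i l = -2
    & forall l1 l2, l1 != l2 -> eta_minus b i = [set l1; l2]%SET ->
        b i l1 = -1 /\ b i l2 = -1].

Definition condition_I (S : finType) (A : S -> S -> int) (r : nat)
    (w : r.-tuple S) : Prop := forall i, cond_N1 (beta A w) i.

Definition condition_II (S : finType) (A : S -> S -> int) (r : nat)
    (w : r.-tuple S) : Prop := forall i, cond_N2 (beta A w) i.

(* Main.v *)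
(* In the chart of the maximal cone given by signs eps, points of the toric
   variety are vectors of K^r and characters are Laurent monomials; the section
   chi^m (d_1 /\ ... /\ d_r)^k of the k-th power of the anticanonical bundle, where
   the d_j are the torus-invariant vector fields, is then, up to sign, the monomial
   with exponents <m, ray> + k, and it is regular iff these are nonnegative.
   (Charts are compared on the torus, which is dense because K is infinite.)
   For k = 1, let m_eps be the vertex where all the
   exponents vanish in the chart of eps.  With a_j = <m_eps, e_j^+>, one has
   <m_eps, e_i^+> + <m_eps, e_i^-> = - sum_(j > i) beta_ij a_j, where one of the
   two terms is -1.  Descending induction on i gives a_i >= -1: under condition II
   the right-hand side is >= sum_(j > i) beta_ij >= -2, so m_eps lies in the
   anticanonical polytope.  Hence the bundle is globally generated, so nef.  Under
   condition I the other term is >= 0, so the nonvanishing locus of the section of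
   m_eps is exactly the affine space of the chart: the bundle is ample.  It is always
   big, since the k-th polytope contains a box of size proportional to k. *)

Require Import Defs.
From mathcomp Require Import all_boot all_order all_algebra.
From mathcomp Require Import complex reals.
From mathcomp Require Import ring zify perm.
From mathcomp Require mpoly.

Set Implicit Arguments.
Unset Strict Implicit.
Unset Printing Implicit Defensive.

Import Order.TTheory GRing.Theory Num.Theory.
Local Open Scope ring_scope.

(** * Polynomial functions on K^N *)

Definition polyfun (K : fieldType) (N : nat) (f : 'rV[K]_N -> K) : Prop :=
  exists P : mpoly.mpoly N K,
    f = fun x : 'rV[K]_N => mpoly.meval (fun i => x ord0 i) P.

Section PolyFun.
Import mpoly.
Variables (K : fieldType) (N : nat).

Lemma polyfunE (f : 'rV[K]_N -> K) : polyfun f ->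
  exists (k : nat) (c : 'I_k -> K) (e : 'I_k -> 'I_N -> nat),
    forall x, f x = \sum_(l < k) c l * \prod_j x ord0 j ^+ e l j.
Proof.
case=> P ->; pose s := msupp P.
exists (size s), (fun l => P@_(tnth (in_tuple s) l)),
  (fun l => tnth (in_tuple s) l) => x.
by rewrite mevalE big_tnth.
Qed.

Lemma eq_polyfun (f g : 'rV[K]_N -> K) : polyfun f -> f =1 g -> polyfun g.
Proof.
by case=> P -> fg; exists P; apply: boolp.funext => x; rewrite -fg.
Qed.

Lemma polyfun_cst (c : K) : @polyfun K N (fun _ : 'rV[K]_N => c).
Proof. by exists c%:MP; apply: boolp.funext => x; rewrite mevalC. Qed.

Lemma polyfun_coord j : @polyfun K N (fun x : 'rV[K]_N => x ord0 j).
Proof. by exists 'X_j; apply: boolp.funext => x; rewrite mevalXU. Qed.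

Lemma polyfunD f g : polyfun f -> polyfun g -> @polyfun K N (fun x => f x + g x).
Proof.
by move=> [P ->] [Q ->]; exists (P + Q); apply: boolp.funext => x; rewrite mevalD.
Qed.

Lemma polyfunM f g : polyfun f -> polyfun g -> @polyfun K N (fun x => f x * g x).
Proof.
by move=> [P ->] [Q ->]; exists (P * Q); apply: boolp.funext => x; rewrite mevalM.
Qed.

Lemma polyfun_sum I (s : seq I) (P : pred I) (f : I -> 'rV[K]_N -> K) :
  (forall i, P i -> polyfun (f i)) -> @polyfun K N (fun x => \sum_(i <- s | P i) f i x).
Proof.
move=> pf; elim: s => [|i s IH].
  by apply: eq_polyfun (polyfun_cst 0) _ => x; rewrite big_nil.
case Pi: (P i).
  by apply: eq_polyfun (polyfunD (pf i Pi) IH) _ => x; rewrite big_cons Pi.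
by apply: eq_polyfun IH _ => x; rewrite big_cons Pi.
Qed.

Lemma polyfun_prod I (s : seq I) (P : pred I) (f : I -> 'rV[K]_N -> K) :
  (forall i, P i -> polyfun (f i)) -> @polyfun K N (fun x => \prod_(i <- s | P i) f i x).
Proof.
move=> pf; elim: s => [|i s IH].
  by apply: eq_polyfun (polyfun_cst 1) _ => x; rewrite big_nil.
case Pi: (P i).
  by apply: eq_polyfun (polyfunM (pf i Pi) IH) _ => x; rewrite big_cons Pi.
by apply: eq_polyfun IH _ => x; rewrite big_cons Pi.
Qed.

Lemma polyfunX f n : polyfun f -> @polyfun K N (fun x => f x ^+ n).
Proof.
move=> pf; elim: n => [|n IH]; first exact: polyfun_cst.
by apply: eq_polyfun (polyfunM pf IH) _ => x; rewrite exprS.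
Qed.

(** A polynomial function is a finite sum of monomials, so these closure properties reach all of
    them; later proofs induct on functions and never on multinomials. *)
Lemma polyfun_ind (Q : ('rV[K]_N -> K) -> Prop) :
    (forall f g, Q f -> f =1 g -> Q g) ->
    (forall c : K, Q (fun=> c)) -> (forall j, Q (fun x => x ord0 j)) ->
    (forall f g, Q f -> Q g -> Q (fun x => f x + g x)) ->
    (forall f g, Q f -> Q g -> Q (fun x => f x * g x)) ->
  forall f, polyfun f -> Q f.
Proof.
move=> Qext Qc Qx QD QM f /polyfunE[k [c [e fE]]].
apply: (Qext (fun x => \sum_(l < k) c l * \prod_j x ord0 j ^+ e l j)) => [|x //].
elim: (index_enum _) => [|l s IH].
  by apply: (Qext _ _ (Qc 0)) => x; rewrite big_nil.
apply: (Qext _ _ (QD _ _ (QM _ _ (Qc (c l)) _) IH)) => [|x]; last first.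
  by rewrite big_cons; congr (_ * _ + _).
elim: (index_enum _) => [|j t IHt].
  by apply: (Qext _ _ (Qc 1)) => x; rewrite big_nil.
apply: (Qext _ _ (QM _ _ _ IHt)) => [|x]; last by rewrite big_cons; congr (_ * _).
elim: (e l j) => [|n IHn]; first exact: Qc.
by apply: (Qext _ _ (QM _ _ (Qx j) IHn)) => x; rewrite exprS.
Qed.

End PolyFun.

(* Spaces with functions whose germs form local rings *)
From mathcomp Require Import boolp classical_sets functions fsbigop.
Import Defs.
Local Open Scope classical_set_scope.

(** A [space] carries no axioms. These make open sets and regular functions local notions and make a
    germ invertible wherever it does not vanish. *)
Record ringed (K : fieldType) (X : space K) : Prop := Ringed {
  ringedT : sopen [set: X];
  ringedI : forall U V : set X, sopen U -> sopen V -> sopen (U `&` V);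
  ringed_open : forall V : set X,
    (forall p, V p -> exists U, [/\ sopen U, U p & U `<=` V]) -> sopen V;
  ringed_reg : forall (V : set X) f,
    (forall p, V p -> exists U g, [/\ sopen U, U p, sreg U g &
       forall q, U q -> V q -> f q = g q]) -> sreg V f;
  ringed_cst : forall (V : set X) (c : K), sreg V (fun=> c);
  ringedD : forall (V : set X) f g,
    sreg V f -> sreg V g -> sreg V (fun p => f p + g p);
  ringedM : forall (V : set X) f g,
    sreg V f -> sreg V g -> sreg V (fun p => f p * g p);
  ringed_neq0 : forall (V : set X) f,
    sopen V -> sreg V f -> sopen [set p | V p /\ f p != 0];
  ringedV : forall (V : set X) f, sopen V -> sreg V f ->
    sreg [set p | V p /\ f p != 0] (fun p => (f p)^-1) }.

Section AlgSpace.
Variables (K : fieldType) (T : Type) (A : set (T -> K)).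

Lemma alg_space_ringed :
    (forall c : K, A (fun=> c)) ->
    (forall f g, A f -> A g -> A (fun p => f p + g p)) ->
    (forall f g, A f -> A g -> A (fun p => f p * g p)) ->
  ringed (alg_space A).
Proof.
move=> Ac AD AM; split.
- by move=> p _; exists (fun=> 1); rewrite oner_eq0; split.
- move=> U V oU oV p [/oU[f [Af fp Uf]] /oV[g [Ag gp Vg]]].
  exists (fun p => f p * g p); split; [exact: AM | by rewrite mulf_neq0 |].
  by move=> q; rewrite mulf_eq0 negb_or => /andP[/Uf ? /Vg ?].
- move=> V VU p /VU[U [oU /oU[g [Ag gp Ug]] UV]].
  by exists g; split=> // q /Ug /UV.
- move=> V f fU p Vp; have [U [g0 [oU Up gU fg]]] := fU p Vp.
  have [h [Ah hp Uh]] := oU p Up; have [a [g [Aa Ag gp gE]]] := gU p Up.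
  (* The extra factor [h] makes the denominator vanish outside [U], the only place where [f] is
     known to agree with [g0]. *)
  exists (fun p => a p * h p), (fun p => g p * h p); split.
  + exact: AM.
  + exact: AM.
  + by rewrite mulf_neq0.
  + move=> q Vq; rewrite mulf_eq0 negb_or => /andP[gq hq].
    by rewrite fg ?gE //; [field; rewrite hq | exact: Uh | exact: Uh].
- move=> V c p _; exists (fun=> c), (fun=> 1); rewrite oner_eq0; split=> //.
  by move=> q _ _; rewrite divr1.
- move=> V f g fV gV p Vp.
  have [a [b [Aa Ab bp fE]]] := fV p Vp; have [c [d [Ac' Ad dp gE]]] := gV p Vp.
  exists (fun p => a p * d p + c p * b p), (fun p => b p * d p); split.
  + by apply: AD; apply: AM.
  + exact: AM.
  + by rewrite mulf_neq0.
  + move=> q Vq; rewrite mulf_eq0 negb_or => /andP[bq dq].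
    by rewrite fE ?gE //; field; rewrite bq dq.
- move=> V f g fV gV p Vp.
  have [a [b [Aa Ab bp fE]]] := fV p Vp; have [c [d [Ac' Ad dp gE]]] := gV p Vp.
  exists (fun p => a p * c p), (fun p => b p * d p); split.
  + exact: AM.
  + exact: AM.
  + by rewrite mulf_neq0.
  + move=> q Vq; rewrite mulf_eq0 negb_or => /andP[bq dq].
    by rewrite fE ?gE //; field; rewrite bq dq.
- move=> V f oV fV p [Vp fp].
  have [a [b [Aa Ab bp fE]]] := fV p Vp; have [h [Ah hp Vh]] := oV p Vp.
  exists (fun p => a p * (b p * h p)); split; first exact: (AM _ _ Aa (AM _ _ Ab Ah)).
    by rewrite !mulf_neq0 //; apply: contraNneq fp => ap; rewrite fE // ap mul0r.
  move=> q; rewrite !mulf_eq0 !negb_or => /andP[aq /andP[bq hq]].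
  by split; [exact: Vh | rewrite fE ?mulf_neq0 ?invr_eq0 //; exact: Vh].
- move=> V f oV fV p [Vp fp].
  have [a [b [Aa Ab bp fE]]] := fV p Vp.
  have ap : a p != 0 by move: fp; rewrite fE // mulf_eq0 negb_or => /andP[].
  (* With [f] = a / b, the inverse is written b^2 / (a b) and not b / a, so that a nonzero
     denominator guarantees that the fraction for [f] is valid. *)
  exists (fun p => b p * b p), (fun p => a p * b p); split; [exact: AM|exact: AM| |].
    by rewrite mulf_neq0.
  move=> q [Vq _]; rewrite mulf_eq0 negb_or => /andP[aq bq].
  by rewrite fE //; field; rewrite aq bq.
Qed.

Variables (T' : Type) (A' : set (T' -> K)) (h : T -> T').
Hypothesis hA : forall f, A' f -> A (f \o h).

Lemma alg_space_open (V : set T') :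
  @sopen K (alg_space A') V -> @sopen K (alg_space A) (h @^-1` V).
Proof.
move=> oV p /oV[g [A'g gp Vg]].
by exists (g \o h); split=> // [|q /Vg]; first exact: hA.
Qed.

Lemma alg_space_reg (V : set T') f :
  @sreg K (alg_space A') V f -> @sreg K (alg_space A) (h @^-1` V) (f \o h).
Proof.
move=> fV p /fV[a [g [A'a A'g gp fE]]].
by exists (a \o h), (g \o h); split=> //; try exact: hA; move=> q; exact: fE.
Qed.

End AlgSpace.

Lemma affine_space_ringed (K : fieldType) N : ringed (affine_space K N).
Proof.
by apply: alg_space_ringed; [exact: polyfun_cst|exact: polyfunD|exact: polyfunM].
Qed.

(** * Local rings and cotangent spaces *)

Section Germs.
Variables (K : fieldType) (X : space K) (rX : ringed X).
Implicit Types (p q : X) (f g h : X -> K) (V W : set X).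

Definition near p (P : X -> Prop) : Prop :=
  exists V, [/\ sopen V, V p & forall q, V q -> P q].

Lemma near_open V p : sopen V -> V p -> near p V.
Proof. by move=> oV Vp; exists V; split. Qed.

Lemma nearW p (P Q : X -> Prop) : (forall q, P q -> Q q) -> near p P -> near p Q.
Proof. by move=> PQ [V [oV Vp VP]]; exists V; split=> // q /VP /PQ. Qed.

Lemma nearI p (P Q : X -> Prop) : near p P -> near p Q -> near p (fun q => P q /\ Q q).
Proof.
move=> [V [oV Vp VP]] [W [oW Wp WQ]]; exists (V `&` W).
by split=> [||q [/VP Pq /WQ Qq]]; [exact: ringedI|split|split].
Qed.

Lemma nearT p (P : X -> Prop) : (forall q, P q) -> near p P.
Proof. by move=> PT; exists setT; split=> //; exact: ringedT rX. Qed.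

Lemma sopen_near V : (forall p, V p -> near p V) -> sopen V.
Proof. by move=> VV; apply: (ringed_open rX) => p /VV[W [oW Wp WV]]; exists W. Qed.

Lemma germ_reg V f p : sopen V -> sreg V f -> V p -> germ p f.
Proof. by move=> oV fV Vp; exists V. Qed.

Lemma reg_germ V f : (forall p, V p -> germ p f) -> sreg V f.
Proof.
move=> fV; apply: (ringed_reg rX) => p /fV[W [oW Wp fW]].
by exists W, f; split.
Qed.

Lemma germ_near p f g : germ p f -> near p (fun q => g q = f q) -> germ p g.
Proof.
move=> [V [oV Vp fV]] [W [oW Wp WP]]; exists (V `&` W).
split=> //; first exact: ringedI.
by apply: (ringed_reg rX) => q [Vq Wq]; exists V, f; split=> // q' _ [_ /WP].
Qed.

Lemma germ_ext p f g : germ p f -> g =1 f -> germ p g.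
Proof. by move=> fp gf; apply: germ_near fp _; exact: nearT. Qed.

Lemma germ_locally p f : germ p f -> near p (fun q => germ q f).
Proof. by move=> [V [oV Vp fV]]; exists V; split=> // q Vq; exists V. Qed.

Lemma germ_cst p (c : K) : germ p (fun=> c).
Proof.
by exists setT; split=> //; [exact: ringedT rX|exact: ringed_cst rX _ _].
Qed.

Lemma germ_both p f g : germ p f -> germ p g ->
  exists V, [/\ sopen V, V p, sreg V f & sreg V g].
Proof.
move=> [V [oV Vp fV]] [W [oW Wp gW]]; exists (V `&` W).
split=> //; first exact: ringedI.
  by apply: reg_germ => q [Vq _]; exists V.
by apply: reg_germ => q [_ Wq]; exists W.
Qed.

Lemma germD p f g : germ p f -> germ p g -> germ p (fun q => f q + g q).
Proof.
move=> fp gp; have [V [oV Vp fV gV]] := germ_both fp gp.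
by exists V; split=> //; exact: ringedD.
Qed.

Lemma germM p f g : germ p f -> germ p g -> germ p (fun q => f q * g q).
Proof.
move=> fp gp; have [V [oV Vp fV gV]] := germ_both fp gp.
by exists V; split=> //; exact: ringedM.
Qed.

Lemma germN p f : germ p f -> germ p (fun q => - f q).
Proof.
move=> fp; apply: germ_ext (germM (germ_cst p (-1)) fp) _ => q.
by rewrite mulN1r.
Qed.

Lemma germB p f g : germ p f -> germ p g -> germ p (fun q => f q - g q).
Proof. by move=> fp gp; apply: germD => //; exact: germN. Qed.

Lemma germ_neq0 p f : germ p f -> f p != 0 -> near p (fun q => f q != 0).
Proof.
move=> [V [oV Vp fV]] fp; exists [set q | V q /\ f q != 0].
by split=> [||q [_]//]; [exact: ringed_neq0|split].
Qed.

Lemma germV p f : germ p f -> f p != 0 -> germ p (fun q => (f q)^-1).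
Proof.
move=> [V [oV Vp fV]] fp; exists [set q | V q /\ f q != 0].
by split=> //; [exact: ringed_neq0|exact: ringedV].
Qed.

Lemma germ_sum I (s : seq I) (f : I -> X -> K) p :
  (forall i, germ p (f i)) -> germ p (fun q => \sum_(i <- s) f i q).
Proof.
move=> fp; elim: s => [|i s IH].
  by apply: germ_ext (germ_cst p 0) _ => q; rewrite big_nil.
by apply: germ_ext (germD (fp i) IH) _ => q; rewrite big_cons.
Qed.

Lemma germ_prod I (s : seq I) (f : I -> X -> K) p :
  (forall i, germ p (f i)) -> germ p (fun q => \prod_(i <- s) f i q).
Proof.
move=> fp; elim: s => [|i s IH].
  by apply: germ_ext (germ_cst p 1) _ => q; rewrite big_nil.
by apply: germ_ext (germM (fp i) IH) _ => q; rewrite big_cons.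
Qed.

Lemma germX p f n : germ p f -> germ p (fun q => f q ^+ n).
Proof.
move=> fp; elim: n => [|n IH]; first exact: germ_cst.
by apply: germ_ext (germM fp IH) _ => q; rewrite exprS.
Qed.

Lemma germ_det n (M : 'I_n -> 'I_n -> X -> K) p :
  (forall i j, germ p (M i j)) ->
  germ p (fun q => \det (\matrix_(i, j) M i j q)).
Proof.
move=> Mp.
apply: (@germ_ext _ (fun q => \sum_(s : 'S_n) (-1) ^+ s * \prod_i M i (s i) q)).
  by apply: germ_sum => s; apply: germM; [exact: germ_cst|exact: germ_prod].
by move=> q; apply: eq_bigr => s _; congr (_ * _); apply: eq_bigr => i _; rewrite mxE.
Qed.

Lemma polyfun_germ n (f : 'rV[K]_n -> K) (phi : X -> 'rV[K]_n) p :
  polyfun f -> (forall j, germ p (fun q => phi q ord0 j)) ->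
  germ p (fun q => f (phi q)).
Proof.
move=> pf phip; move: f pf; apply: polyfun_ind => [f g fp fg|c|j|f g|f g].
- by apply: germ_ext fp _ => q; rewrite fg.
- exact: germ_cst.
- exact: phip.
- exact: germD.
- exact: germM.
Qed.

Lemma sqmax_near p f g : in_sqmax p f -> near p (fun q => g q = f q) -> in_sqmax p g.
Proof.
move=> [V [N [a [b [oV Vp abV fE]]]]] [W [oW Wp WP]].
exists (V `&` W), N, a, b; split=> //; first exact: ringedI.
  move=> i; have [aV bV a0 b0] := abV i.
  by split=> //; apply: reg_germ => q [Vq _]; exists V.
by move=> q [Vq Wq]; rewrite WP // fE.
Qed.

Lemma sqmax_ext p f g : in_sqmax p f -> g =1 f -> in_sqmax p g.
Proof. by move=> fp gf; apply: sqmax_near fp _; exact: nearT. Qed.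

Lemma sqmax0 p : in_sqmax p (fun=> 0).
Proof.
exists setT, 0%N, (fun _ _ => 0), (fun _ _ => 0).
by split=> //; [exact: ringedT rX|case|move=> q _; rewrite big_ord0].
Qed.

Lemma sqmaxD p f g : in_sqmax p f -> in_sqmax p g -> in_sqmax p (fun q => f q + g q).
Proof.
move=> [V [N [a [b [oV Vp abV fE]]]]] [W [M [c [d [oW Wp cdW gE]]]]].
exists (V `&` W), (N + M)%N,
  (fun i => match fintype.split i with inl i => a i | inr i => c i end),
  (fun i => match fintype.split i with inl i => b i | inr i => d i end).
split=> //; first exact: ringedI.
  move=> i; case: (fintype.split i) => {}i.
    have [aV bV a0 b0] := abV i.
    by split=> //; apply: reg_germ => q [Vq _]; exists V.
  have [aV bV a0 b0] := cdW i.
  by split=> //; apply: reg_germ => q [_ Wq]; exists W.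
move=> q [Vq Wq]; rewrite fE // gE // big_split_ord /=.
congr (_ + _); apply: eq_bigr => i _.
  case: splitP => j /=; first by move/val_inj->.
  by move=> e; have := ltn_ord i; rewrite e ltnNge leq_addr.
case: splitP => j /= e; first by have := ltn_ord j; rewrite -e ltnNge leq_addr.
by move/addnI/val_inj: e => ->.
Qed.

Lemma sqmaxM p f h : germ p h -> in_sqmax p f -> in_sqmax p (fun q => h q * f q).
Proof.
move=> [W [oW Wp hW]] [V [N [a [b [oV Vp abV fE]]]]].
exists (V `&` W), N, (fun i q => h q * a i q), b; split=> //; first exact: ringedI.
  move=> i; have [aV bV a0 b0] := abV i; split=> //; last by rewrite a0 mulr0.
    by apply: reg_germ => q [Vq Wq]; apply: germM; [exists W|exists V].
  by apply: reg_germ => q [Vq Wq]; exists V.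
by move=> q [Vq Wq]; rewrite fE // big_distrr; apply: eq_bigr => i _; exact: mulrA.
Qed.

Lemma sqmax_sum I (s : seq I) (f : I -> X -> K) p :
  (forall i, in_sqmax p (f i)) -> in_sqmax p (fun q => \sum_(i <- s) f i q).
Proof.
move=> fp; elim: s => [|i s IH].
  by apply: sqmax_ext (sqmax0 p) _ => q; rewrite big_nil.
by apply: sqmax_ext (sqmaxD (fp i) IH) _ => q; rewrite big_cons.
Qed.

Lemma sqmax_mul p f g : germ p f -> germ p g -> f p = 0 -> g p = 0 ->
  in_sqmax p (fun q => f q * g q).
Proof.
move=> fp gp f0 g0; have [V [oV Vp fV gV]] := germ_both fp gp.
exists V, 1%N, (fun=> f), (fun=> g); split=> // q _.
by rewrite big_ord1.
Qed.

(** * Differential calculus modulo the square of the maximal ideal *)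

Section Differential.
Variables (n : nat) (phi : 'I_n -> X -> K) (p : X).

Lemma diff_near f g c : differential_at phi p f c ->
  near p (fun q => g q = f q) -> differential_at phi p g c.
Proof.
move=> dfc gf; have [W [_ Wp /(_ _ Wp) gp]] := gf.
by apply: sqmax_near dfc _; apply: nearW gf => q ->; rewrite gp.
Qed.

Lemma diff_ext f g c c' : differential_at phi p f c -> g =1 f -> c =1 c' ->
  differential_at phi p g c'.
Proof.
move=> dfc gf cc'; apply: sqmax_ext dfc _ => q; rewrite !gf.
by congr (_ - _); apply: eq_bigr => j _; rewrite cc'.
Qed.

Lemma diff_cst c : differential_at phi p (fun=> c) (fun=> 0).
Proof.
apply: sqmax_ext (sqmax0 p) _ => q; rewrite subrr big1 ?subr0 // => j _.
by rewrite mul0r.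
Qed.

Lemma diff_coord j : differential_at phi p (phi j) (fun k => (k == j)%:R).
Proof.
apply: sqmax_ext (sqmax0 p) _ => q; rewrite (bigD1 j) //= eqxx mul1r.
by rewrite big1 ?addr0 ?subrr // => k /negPf ->; rewrite mul0r.
Qed.

Lemma diffD f g c d : differential_at phi p f c -> differential_at phi p g d ->
  differential_at phi p (fun q => f q + g q) (fun j => c j + d j).
Proof.
move=> fc gd; apply: sqmax_ext (sqmaxD fc gd) _ => q.
under eq_bigr do rewrite mulrDl; rewrite big_split /=; ring.
Qed.

(** Expand fg - f(p)g(p) as (f - f(p))(g - g(p)) + f(p)(g - g(p)) + g(p)(f - f(p)); the first term
    is a product of two elements of the maximal ideal. *)
Lemma diffM f g c d : germ p f -> germ p g ->
  differential_at phi p f c -> differential_at phi p g d ->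
  differential_at phi p (fun q => f q * g q) (fun j => f p * d j + g p * c j).
Proof.
move=> fp gp fc gd.
have f0 : in_sqmax p (fun q => (f q - f p) * (g q - g p)).
  by apply: sqmax_mul; rewrite ?subrr //; apply: germB => //; exact: germ_cst.
have fd := sqmaxM (germ_cst p (f p)) gd; have gc := sqmaxM (germ_cst p (g p)) fc.
apply: sqmax_ext (sqmaxD f0 (sqmaxD fd gc)) _ => q.
under eq_bigr do rewrite mulrDl -!mulrA.
rewrite big_split /= -!big_distrr /=; ring.
Qed.

(** Quotient rule for f = a / g, obtained by solving the product expansion of a = fg for f - f(p).
    Germs are given on a neighbourhood only, hence the local equation. *)
Lemma diff_div f g a c d : germ p f -> germ p g -> g p != 0 ->
  near p (fun q => a q = f q * g q) ->
  differential_at phi p a c -> differential_at phi p g d ->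
  differential_at phi p f (fun j => (c j - f p * d j) / g p).
Proof.
move=> fp gp gp0 aE ac gd; have [W [_ Wp /(_ _ Wp) ap]] := aE.
have f0 : in_sqmax p (fun q => (f q - f p) * (g q - g p)).
  by apply: sqmax_mul; rewrite ?subrr //; apply: germB => //; exact: germ_cst.
have s := sqmaxM (germ_cst p (g p)^-1) (sqmaxD (sqmaxD ac
  (sqmaxM (germ_cst p (- f p)) gd)) (sqmaxM (germ_cst p (-1)) f0)).
apply: sqmax_near s _; apply: nearW aE => q aq.
have -> : \sum_(j < n) (c j - f p * d j) / g p * (phi j q - phi j p) =
    (g p)^-1 * (\sum_(j < n) c j * (phi j q - phi j p)
      - f p * \sum_(j < n) d j * (phi j q - phi j p)).
  rewrite big_distrr -sumrB big_distrr; apply: eq_bigr => j _ /=; ring.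
by rewrite aq ap; field.
Qed.

Lemma diff_chain m (psi : 'I_m -> X -> K) f c (d : 'I_n -> 'I_m -> K) :
  differential_at phi p f c -> (forall j, differential_at psi p (phi j) (d j)) ->
  differential_at psi p f (fun k => \sum_j c j * d j k).
Proof.
move=> fc phid.
have s := sqmaxD fc (sqmax_sum (index_enum 'I_n)
  (fun j => sqmaxM (germ_cst p (c j)) (phid j))).
apply: sqmax_ext s _ => q.
have -> : \sum_(k < m) (\sum_j c j * d j k) * (psi k q - psi k p) =
    \sum_j c j * \sum_(k < m) d j k * (psi k q - psi k p).
  under eq_bigr do rewrite mulr_suml; rewrite exchange_big /=.
  by apply: eq_bigr => j _; rewrite big_distrr; apply: eq_bigr => k _ /=; rewrite mulrA.
under [X in _ = _ + X]eq_bigr do rewrite mulrBr.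
rewrite sumrB; ring.
Qed.

End Differential.

(** * Jacobian matrices between coordinate systems *)

Section Jacobian.
Variable n : nat.
Implicit Types (x y z : coords X n).

Lemma germ_cfun x p i : cdom x p -> germ p (cfun x i).
Proof. by move=> xp; exists (cdom x); split=> //; [exact: cdom_open|exact: cfun_reg]. Qed.

Lemma coords_uniq x p f c c' : cdom x p -> germ p f ->
  differential_at (cfun x) p f c -> differential_at (cfun x) p f c' -> c =1 c'.
Proof.
move=> xp fp fc fc'; have [e [_ eu]] := cfun_basis xp fp.
have rowE (d : 'I_n -> K) : differential_at (cfun x) p f d -> e = \row_j d j.
  by move=> fd; apply: eu; apply: diff_ext fd _ _ => // j; rewrite mxE.
by move=> j; have := rowE c fc; rewrite (rowE c' fc') => /rowP/(_ j); rewrite !mxE.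
Qed.

(** [jacobian] is a choice with default 0; since the differentials of [y] form a basis, suitable
    rows exist and the choice meets its specification. *)
Lemma jacobianP x y p i : cdom x p -> cdom y p ->
  differential_at (cfun y) p (cfun x i) (jacobian x y p i).
Proof.
move=> xp yp; rewrite /jacobian; move: i.
apply: (@xgetPex _ 0 [set J : 'M[K]_n | forall i, differential_at (cfun y) p (cfun x i) (J i)]).
have /choice[c cP] : forall i, exists c : 'rV[K]_n, differential_at (cfun y) p (cfun x i) (c ord0).
  by move=> i; have [c [cP _]] := cfun_basis yp (germ_cfun i xp); exists c.
by exists (\matrix_i c i) => i; apply: diff_ext (cP i) _ _ => // j; rewrite mxE.
Qed.

Lemma jacobian_uniq x y p i c : cdom x p -> cdom y p ->
  differential_at (cfun y) p (cfun x i) c -> jacobian x y p i =1 c.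
Proof.
move=> xp yp xc; apply: (coords_uniq yp (germ_cfun i xp)) => //.
exact: jacobianP.
Qed.

Lemma jacobianM x y z p : cdom x p -> cdom y p -> cdom z p ->
  jacobian x z p = jacobian x y p *m jacobian y z p.
Proof.
move=> xp yp zp; apply/matrixP => i j; rewrite mxE.
have := diff_chain (jacobianP i xp yp) (fun k => jacobianP k yp zp).
by move=> /(jacobian_uniq xp zp) ->.
Qed.

Lemma jacobian1 x p : cdom x p -> jacobian x x p = 1%:M.
Proof.
move=> xp; apply/matrixP => i j; rewrite mxE.
by rewrite (jacobian_uniq xp xp (diff_coord _ _ i)) eq_sym.
Qed.

Lemma det_jacobianV x y p : cdom x p -> cdom y p ->
  \det (jacobian x y p) * \det (jacobian y x p) = 1.
Proof. by move=> xp yp; rewrite -det_mulmx -jacobianM // jacobian1 // det1. Qed.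

Lemma det_jacobian_neq0 x y p : cdom x p -> cdom y p -> \det (jacobian x y p) != 0.
Proof.
move=> xp yp; apply: contra_eq_neq (det_jacobianV xp yp) => ->.
by rewrite mul0r eq_sym oner_eq0.
Qed.

End Jacobian.

End Germs.

(** * Charts and gluing *)

Section ToricCharts.
Variables (K : fieldType) (r : nat) (b : 'I_r -> 'I_r -> int).
Implicit Types (eps del : 'I_r -> bool) (x y : 'rV[K]_r) (m : 'rV[int]_r).
Implicit Types (sigma tau : {set bool * 'I_r}).
Local Notation F := (limit_fan b).

(** A maximal cone picks one of e_i^+ and e_i^- for every i, so these cones are indexed by sign
    vectors. *)
Definition max_cone eps : {set bool * 'I_r} := [set x | x.1 == eps x.2]%SET.

Lemma max_cone_in eps : max_cone eps \in cones F.
Proof.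
by rewrite inE; apply/forallP => i; rewrite !inE /=; case: (eps i).
Qed.

Definition rays eps : 'M[int]_r := \matrix_(i, j) limit_ray b (eps j, j) ord0 i.

Lemma rays_diag eps i : rays eps i i = (-1) ^+ (~~ eps i).
Proof.
rewrite !mxE /limit_ray /=; case: (eps i); rewrite /= ?mxE ?eqxx //.
rewrite summxE big1 ?mxE ?eqxx ?subr0 // => j ij.
by rewrite !mxE /= (negPf (_ : i != j)) ?mulr0 // neq_ltn ij.
Qed.

Lemma rays_trig eps : is_trig_mx (rays eps).
Proof.
apply/is_trig_mxP => i j ij; rewrite !mxE /limit_ray.
have ne : i != j by rewrite neq_ltn ij.
case: (eps j); rewrite /= ?mxE ?(negPf ne) //= summxE big1 ?subr0 ?oppr0 //.
move=> k jk; rewrite !mxE /= (negPf (_ : i != k)) ?mulr0 //.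
by rewrite neq_ltn (ltn_trans ij jk).
Qed.

(** Besides -e_j^+, the ray e_j^- involves only later basis vectors. The matrix of generators is
    thus triangular with diagonal entries 1 or -1, and every maximal cone is unimodular. *)
Lemma det_rays_sqr eps : \det (rays eps) * \det (rays eps) = 1.
Proof.
rewrite (det_trig (rays_trig eps)) -big_split big1 // => i _.
by rewrite rays_diag; case: (eps i).
Qed.

Lemma rays_unit eps : rays eps \in unitmx.
Proof.
by rewrite unitmxE; apply/unitrPr; exists (\det (rays eps)); rewrite det_rays_sqr.
Qed.

(** The exponent of the j-th coordinate of the chart of [eps] in the character [m], that is, the
    pairing of [m] with the j-th ray of the cone. *)
Definition ex eps m j : int := (m *m rays eps) ord0 j.

Lemma pairing_ray eps m j : pairing m (limit_ray b (eps j, j)) = ex eps m j.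
Proof. by rewrite /ex mxE; apply: eq_bigr => i _; rewrite mxE. Qed.

Lemma ex0 eps j : ex eps 0 j = 0.
Proof. by rewrite /ex mul0mx mxE. Qed.

Lemma exD eps m m' j : ex eps (m + m') j = ex eps m j + ex eps m' j.
Proof. by rewrite /ex mulmxDl mxE. Qed.

Lemma exN eps m j : ex eps (- m) j = - ex eps m j.
Proof. by rewrite /ex mulNmx mxE. Qed.

Lemma ex_sum eps I (s : seq I) (f : I -> 'rV[int]_r) j :
  ex eps (\sum_(i <- s) f i) j = \sum_(i <- s) ex eps (f i) j.
Proof. by rewrite /ex mulmx_suml summxE. Qed.

Lemma exMn eps m n j : ex eps (m *+ n) j = ex eps m j *+ n.
Proof. by elim: n => [|n IH]; rewrite ?ex0 // !mulrS exD IH. Qed.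

Definition dual_basis eps j : 'rV[int]_r := row j (invmx (rays eps)).

Lemma ex_dual_basis eps j k : ex eps (dual_basis eps j) k = (j == k)%:R.
Proof. by rewrite /ex -row_mul mulVmx ?rays_unit // !mxE. Qed.

Lemma dual_basis_sum eps m : m = \sum_j dual_basis eps j *~ ex eps m j.
Proof.
rewrite -[LHS](mulmxK (rays_unit eps)) mulmx_sum_row.
by apply: eq_bigr => j _; rewrite -scaler_int intz.
Qed.

Lemma dual_coneE eps sigma m : sigma \subset max_cone eps ->
  @dual_cone r F sigma m <-> (forall j, (eps j, j) \in sigma -> 0 <= ex eps m j).
Proof.
move=> /fintype.subsetP sub; split=> [dm j|dm [e j] ej].
  by rewrite -pairing_ray; apply: dm.
by have := sub _ ej; rewrite inE /= => /eqP ee; move: ej; rewrite ee /= pairing_ray; apply: dm.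
Qed.

Definition mon eps x m : K := \prod_j x ord0 j ^ ex eps m j.

Lemma mon0 eps x : mon eps x 0 = 1.
Proof. by apply: big1 => j _; rewrite ex0. Qed.

(** Integer powers of 0 are not additive when exponents of both signs meet, since 0 is its own
    inverse here; the hypothesis rules this out coordinate by coordinate. *)
Lemma monD eps x m m' :
  (forall j, x ord0 j != 0 \/ (0 <= ex eps m j /\ 0 <= ex eps m' j)) ->
  mon eps x (m + m') = mon eps x m * mon eps x m'.
Proof.
move=> xm; rewrite -big_split; apply: eq_bigr => j _; rewrite exD.
have [x0|[]] := xm j; first by rewrite expfzDr.
by case: (ex _ _ _) => // k _; case: (ex _ _ _) => // l _; rewrite exprzD_nat.
Qed.

Lemma mon_dual_basis eps x j : mon eps x (dual_basis eps j) = x ord0 j.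
Proof.
rewrite /mon (bigD1 j) //= ex_dual_basis eqxx expr1z big1 ?mulr1 // => k kj.
by rewrite ex_dual_basis eq_sym (negPf kj).
Qed.

Lemma mon_character eps sigma x : sigma \subset max_cone eps ->
  (forall j, (eps j, j) \notin sigma -> x ord0 j != 0) ->
  @is_character K r F sigma (mon eps x).
Proof.
move=> sub x0; split=> [|m m' /(dual_coneE _ sub) dm /(dual_coneE _ sub) dm'].
  exact: mon0.
apply: monD => j; have [js|/x0] := boolP ((eps j, j) \in sigma); last by left.
by right; split; [exact: dm|exact: dm'].
Qed.

Definition char_coord eps (g : 'rV[int]_r -> K) : 'rV[K]_r :=
  \row_j g (dual_basis eps j).

Section Character.
Variables (eps : 'I_r -> bool) (sigma : {set bool * 'I_r}) (g : 'rV[int]_r -> K).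
Hypotheses (sub : sigma \subset max_cone eps) (gP : @is_character K r F sigma g).

Let dualP m := dual_coneE m sub.

Lemma dual_basis_in j : @dual_cone r F sigma (dual_basis eps j).
Proof. by apply/dualP => k _; rewrite ex_dual_basis; case: eqP. Qed.

Lemma dual_basisN_in j : (eps j, j) \notin sigma ->
  @dual_cone r F sigma (- dual_basis eps j).
Proof.
move=> js; apply/dualP => k; rewrite exN ex_dual_basis.
by case: eqVneq => [<-|_ _]; [rewrite (negPf js)|rewrite oppr0].
Qed.

Lemma char_coord_neq0 j : (eps j, j) \notin sigma -> char_coord eps g ord0 j != 0.
Proof.
move=> js; rewrite mxE; have [g0 gD] := gP.
apply: contra_eq_neq (gD _ _ (dual_basis_in j) (dual_basisN_in js)) => ->.
by rewrite subrr g0 mul0r oner_eq0.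
Qed.

Lemma charMn m n : @dual_cone r F sigma m ->
  @dual_cone r F sigma (m *+ n) /\ g (m *+ n) = g m ^+ n.
Proof.
have [g0 gD] := gP => dm; elim: n => [|n [dn gn]].
  by rewrite mulr0n; split=> //; apply/dualP => j _; rewrite ex0.
rewrite mulrS exprS gD // gn; split=> //; apply/dualP => j js; rewrite exD.
by apply: addr_ge0; [exact: (dualP _).1 dm _ js|exact: (dualP _).1 dn _ js].
Qed.

(** Converse of [mon_character]: a point of the chart of a face [sigma] is determined by its values
    on the dual basis, and the coordinates off [sigma] are units. So this chart is the locus of K^r
    where those coordinates are nonzero. *)
Lemma char_mon m : @dual_cone r F sigma m -> g m = mon eps (char_coord eps g) m.
Proof.
have [g0 gD] := gP => /dualP dm.
have gz j : @dual_cone r F sigma (dual_basis eps j *~ ex eps m j) /\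
    g (dual_basis eps j *~ ex eps m j) = char_coord eps g ord0 j ^ ex eps m j.
  case E: (ex eps m j) => [n|n].
    by have [] := charMn n (dual_basis_in j); rewrite mxE.
  (* A negative exponent can occur only at a ray outside [sigma], where the opposite of the dual
     basis vector also lies in the dual cone. *)
  have js : (eps j, j) \notin sigma by apply/negP => /dm; rewrite E.
  have [dn gn] := charMn n.+1 (dual_basisN_in js).
  have {dn gn}[dn gn] : @dual_cone r F sigma (dual_basis eps j *~ Negz n) /\
    g (dual_basis eps j *~ Negz n) = g (- dual_basis eps j) ^+ n.+1.
    by rewrite NegzE mulrNz -mulNrz -pmulrn.
  split=> //; rewrite gn -[RHS]/((_ ^+ n.+1)^-1) -exprVn; congr (_ ^+ _).
  have := char_coord_neq0 js; rewrite mxE => gj0.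
  apply: (mulfI gj0); rewrite divff // -gD ?subrr //.
    exact: dual_basis_in.
  exact: dual_basisN_in.
rewrite {1}(dual_basis_sum eps m) /mon.
suff [] : @dual_cone r F sigma (\sum_j dual_basis eps j *~ ex eps m j) /\
  g (\sum_j dual_basis eps j *~ ex eps m j) =
  \prod_j char_coord eps g ord0 j ^ ex eps m j by [].
elim: (index_enum _) => [|j s [dI IH]].
  by rewrite !big_nil; split=> //; apply/dualP => j _; rewrite ex0.
have [dj gj] := gz j; rewrite !big_cons gD // gj IH; split=> //.
apply/dualP => k ks; rewrite exD.
by apply: addr_ge0; [exact: (dualP _).1 dj _ ks|exact: (dualP _).1 dI _ ks].
Qed.

End Character.

Lemma dual_coneS sigma tau m : sigma \subset tau ->
  @dual_cone r F tau m -> @dual_cone r F sigma m.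
Proof. by move=> /fintype.subsetP st dm x /st /dm. Qed.

Lemma is_characterS sigma tau (g : 'rV[int]_r -> K) : sigma \subset tau ->
  @is_character K r F sigma g -> @is_character K r F tau g.
Proof.
move=> st [g0 gD]; split=> // m m' dm dm'; apply: gD.
  exact: dual_coneS st dm.
exact: dual_coneS st dm'.
Qed.

Lemma sub_max_cone (sigma : {set bool * 'I_r}) :
  sigma \in cones F -> sigma \subset max_cone (fun i => (true, i) \in sigma).
Proof.
rewrite inE => /forallP sP; apply/fintype.subsetP => -[[] i] is_; rewrite inE /= ?is_ //.
by have := sP i; rewrite is_ andbT => /negPf ->.
Qed.

(* The middle point lies in the chart of the intersection of the three cones. *)
Lemma glued_trans (u v w : chart_point K F) : glued u v -> glued v w -> glued u w.
Proof.
move=> [g [gP gu gv]] [h [hP hv hw]].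
pose sv := sval (tag v); pose su := sval (tag u); pose sw := sval (tag w).
pose eps i := (true, i) \in sv.
have sub : sv \subset max_cone eps := sub_max_cone (svalP (tag v)).
have sg : su :&: sv \subset max_cone eps by apply: fintype.subset_trans sub; exact: finset.subsetIr.
have sh : sv :&: sw \subset max_cone eps by apply: fintype.subset_trans sub; exact: finset.subsetIl.
have cg : char_coord eps g = char_coord eps h.
  by apply/rowP => j; rewrite !mxE -gv -?hv //; apply: dual_basis_in.
pose x := char_coord eps g.
have x0 j : (eps j, j) \notin su :&: sv :&: sw -> x ord0 j != 0.
  rewrite inE negb_and => /orP[|] js; first exact: (char_coord_neq0 sg gP).
  by rewrite /x cg; apply: (char_coord_neq0 sh hP); rewrite inE negb_and js orbT.
exists (mon eps x); split.
- apply: (is_characterS (sigma := su :&: sv :&: sw)); last first.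
    by apply: mon_character x0; apply: fintype.subset_trans sg; exact: finset.subsetIl.
  by rewrite -finset.setIA finset.setIS // finset.subsetIr.
- by move=> m dm; rewrite gu // (char_mon sg gP) //; apply: dual_coneS dm; exact: finset.subsetIl.
- move=> m dm; rewrite hw // (char_mon sh hP) ?/x ?cg //; apply: dual_coneS dm.
  exact: finset.subsetIr.
Qed.

Lemma glued_sym (u v : chart_point K F) : glued u v -> glued v u.
Proof. by move=> [g [gP gu gv]]; exists g; split=> //; rewrite finset.setIC. Qed.

Lemma glued_eq (u v : chart_point K F) :
  chart_incl (tagged u) = chart_incl (tagged v) <-> glued u v.
Proof.
case: u v => [su gu] [sv gv]; split=> [/(congr1 sval) /= E|uv].
  have : [set c | glued (existT _ sv gv) c] (existT _ sv gv).
    exists (sval gv); split=> //; rewrite /= finset.setIid; exact: (svalP gv).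
  by rewrite -E.
apply: eq_exist; apply/seteqP; split=> c /= h; last exact: glued_trans uv h.
exact: glued_trans (glued_sym uv) h.
Qed.

Definition max_chart eps : {sigma : {set ray_idx F} | sigma \in cones F} :=
  exist _ (max_cone eps) (max_cone_in eps).

Lemma mon_max_character eps x : @is_character K r F (max_cone eps) (mon eps x).
Proof. by apply: mon_character => // j; rewrite !inE eqxx. Qed.

Definition mon_point eps x : toric_chart K (max_cone eps : {set ray_idx F}) :=
  exist _ (mon eps x) (mon_max_character eps x).

Definition phi eps x : toric_variety K F :=
  @chart_incl K r F (max_chart eps) (mon_point eps x).

(** Every cone is completed to a maximal one by adding e_i^- whenever e_i^+ is absent, so the
    maximal charts already cover the variety. *)
Lemma chart_incl_phi (sigma : {sigma : {set ray_idx F} | sigma \in cones F})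
    (g : toric_chart K (sval sigma)) :
  let eps i := (true, i) \in sval sigma in
  chart_incl g = phi eps (char_coord eps (sval g)).
Proof.
move=> eps; have sub := sub_max_cone (svalP sigma).
apply/(glued_eq (existT _ sigma g) (existT _ (max_chart eps) (mon_point eps _))).
exists (sval g); split=> //= [|m dm].
  by rewrite (finset.setIidPl sub); exact: (svalP g).
rewrite -(char_mon sub (svalP g)) //; exact: dual_coneS dm.
Qed.

Lemma phi_surj (p : toric_variety K F) : exists eps x, p = phi eps x.
Proof.
case: p => P Pa; have [[sigma g] PE] := Pa.
exists (fun i => (true, i) \in sval sigma),
  (char_coord (fun i => (true, i) \in sval sigma) (sval g)).
by rewrite -chart_incl_phi; apply: eq_exist.
Qed.

(** The change of charts is monomial. The coordinates at which the two cones differ are units on the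
    chart of the common face, which is where both charts overlap. *)
Lemma phi_eq eps del x y : phi eps x = phi del y <->
  (forall j, eps j != del j -> x ord0 j != 0) /\
  (forall j, y ord0 j = mon eps x (dual_basis del j)).
Proof.
rewrite /phi (glued_eq (existT _ (max_chart eps) (mon_point eps x))
  (existT _ (max_chart del) (mon_point del y))) /glued /=.
have sub1 : max_cone eps :&: max_cone del \subset max_cone eps by exact: finset.subsetIl.
have sub2 : max_cone eps :&: max_cone del \subset max_cone del by exact: finset.subsetIr.
split=> [[g [gP gx gy]]|[x0 yE]].
  have cx : char_coord eps g = x.
    by apply/rowP => j; rewrite mxE -gx ?mon_dual_basis //; apply: dual_basis_in.
  split=> [j jd|j].
    by rewrite -cx; apply: (char_coord_neq0 sub1 gP); rewrite !inE /= eqxx.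
  rewrite -cx -(char_mon sub1 gP); last first.
    by apply: dual_coneS sub2 _; exact: dual_basis_in.
  by rewrite -gy ?mon_dual_basis //; exact: dual_basis_in.
have mP : @is_character K r F (max_cone eps :&: max_cone del) (mon eps x).
  by apply: mon_character => // j; rewrite !inE /= eqxx; exact: x0.
exists (mon eps x); split=> // m dm.
rewrite (char_mon sub2 mP); last by apply: dual_coneS dm.
by congr (mon _ _ _); apply/rowP => j; rewrite mxE.
Qed.

Lemma phi_inj eps : injective (phi eps).
Proof.
move=> x y /phi_eq[_ yE]; apply/rowP => j.
by rewrite yE mon_dual_basis.
Qed.

(** A point of the torus is a character of the zero cone, whose dual is the whole lattice; its value
    at [m] does not depend on the chart. *)
Lemma mon_phi_eq eps del x y m : phi eps x = phi del y ->
  (forall j, x ord0 j != 0) -> mon del y m = mon eps x m.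
Proof.
move=> /phi_eq[_ yE] x0.
have mP : @is_character K r F finset.set0 (mon eps x).
  by apply: mon_character => //; exact: finset.sub0set.
rewrite [RHS](char_mon (finset.sub0set (max_cone del)) mP); last by move=> i; rewrite inE.
by congr (mon _ _ _); apply/rowP => j; rewrite mxE.
Qed.

Lemma polyfun_mon eps m : @dual_cone r F (max_cone eps) m ->
  @polyfun K r (fun x => mon eps x m).
Proof.
move=> /dual_coneE dm; apply: polyfun_prod => j _.
have : 0 <= ex eps m j by apply: dm; rewrite ?fintype.subxx // inE.
case: (ex eps m j) => // n _; apply: polyfunX; exact: polyfun_coord.
Qed.

Definition char_alg sigma : set ({g | @is_character K r F sigma g} -> K) :=
  [set f | exists (k : nat) (c : 'I_k -> K) (m : 'I_k -> 'rV[int]_r),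
     (forall i, @dual_cone r F sigma (m i)) /\
     f = fun g => \sum_(i < k) c i * sval g (m i)].

Lemma mon_point_alg eps f : char_alg (sigma := max_cone eps) f ->
  polyfun (f \o mon_point eps).
Proof.
move=> [k [c [m [dm ->]]]]; apply: polyfun_sum => l _.
by apply: polyfunM; [exact: polyfun_cst|exact: polyfun_mon].
Qed.

Lemma phi_open eps (V : set (toric_variety K F)) :
  sopen V -> @sopen K (affine_space K r) (phi eps @^-1` V).
Proof. by move=> oV; exact: (alg_space_open (@mon_point_alg eps) (oV (max_chart eps))). Qed.

Lemma phi_reg eps (V : set (toric_variety K F)) (f : toric_variety K F -> K) :
  sreg V f -> @sreg K (affine_space K r) (phi eps @^-1` V) (f \o phi eps).
Proof. by move=> fV; exact: (alg_space_reg (@mon_point_alg eps) (fV (max_chart eps))). Qed.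

Lemma char_coord_alg sigma eps f : sigma \subset max_cone eps -> polyfun f ->
  char_alg (f \o (fun g : {g | @is_character K r F sigma g} => char_coord eps (sval g))).
Proof.
move=> sub /polyfunE[k [c [e fE]]].
exists k, c, (fun l => \sum_j dual_basis eps j *+ e l j); split=> [l|].
  apply/(dual_coneE _ sub) => j _; rewrite ex_sum; apply: sumr_ge0 => i _.
  by rewrite exMn mulrn_wge0 // ex_dual_basis.
apply: funext => -[g gP] /=; rewrite fE; apply: eq_bigr => l _; congr (_ * _).
suff [] : @dual_cone r F sigma (\sum_j dual_basis eps j *+ e l j) /\
  \prod_j char_coord eps g ord0 j ^+ e l j = g (\sum_j dual_basis eps j *+ e l j) by [].
have [g0 gD] := gP; elim: (index_enum _) => [|j s [ds gs]].
  by rewrite !big_nil g0; split=> // i _; rewrite /pairing big1 // => k' _; rewrite mxE mul0r.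
have [dj gj] := charMn sub gP (e l j) (dual_basis_in sub j).
rewrite !big_cons gD // gj gs mxE; split=> //; apply/(dual_coneE _ sub) => i is_.
by rewrite exD; apply: addr_ge0; [move/(dual_coneE _ sub): dj|move/(dual_coneE _ sub): ds]; apply.
Qed.

(** Maximal charts suffice by [chart_incl_phi]. There the structure is that of affine space, because
    the characters of the dual cone and the polynomials in the dual basis coordinates are the same
    functions. *)
Lemma toric_openP (V : set (toric_variety K F)) :
  sopen V <-> forall eps, @sopen K (affine_space K r) (phi eps @^-1` V).
Proof.
split=> [oV eps|oV sigma]; first exact: phi_open.
have := alg_space_open (A := @char_alg (sval sigma))
  (fun f => @char_coord_alg _ _ f (sub_max_cone (svalP sigma)))
  (oV (fun i => (true, i) \in sval sigma)).
by congr sopen; apply/funext => g; rewrite /preimage /= chart_incl_phi.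
Qed.

Lemma toric_regP (V : set (toric_variety K F)) (f : toric_variety K F -> K) :
  sreg V f <-> forall eps, @sreg K (affine_space K r) (phi eps @^-1` V) (f \o phi eps).
Proof.
split=> [fV eps|fV sigma]; first exact: phi_reg.
have := alg_space_reg (A := @char_alg (sval sigma))
  (fun f => @char_coord_alg _ _ f (sub_max_cone (svalP sigma)))
  (fV (fun i => (true, i) \in sval sigma)).
congr sreg; first by apply/funext => g; rewrite /preimage /= chart_incl_phi.
by apply/funext => g; rewrite /= chart_incl_phi.
Qed.

Lemma toric_ringed : ringed (toric_variety K F).
Proof.
have A := affine_space_ringed K r.
split.
- by apply/toric_openP => eps; exact: ringedT A.
- move=> U V /toric_openP oU /toric_openP oV; apply/toric_openP => eps.
  exact: (ringedI A (oU eps) (oV eps)).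
- move=> V VU; apply/toric_openP => eps; apply: (ringed_open A) => x /VU[U [oU Ux UV]].
  by exists (phi eps @^-1` U); split=> [||y /UV//]; first exact: phi_open.
- move=> V f fV; apply/toric_regP => eps; apply: (ringed_reg A) => x /fV[U [g [oU Ux gU fg]]].
  exists (phi eps @^-1` U), (g \o phi eps); split=> //; first exact: phi_open.
    exact: phi_reg.
  by move=> y Uy Vy; exact: fg.
- by move=> V c; apply/toric_regP => eps; exact: (ringed_cst A).
- move=> V f g /toric_regP fV /toric_regP gV; apply/toric_regP => eps.
  exact: (ringedD A (fV eps) (gV eps)).
- move=> V f g /toric_regP fV /toric_regP gV; apply/toric_regP => eps.
  exact: (ringedM A (fV eps) (gV eps)).
- move=> V f /toric_openP oV /toric_regP fV; apply/toric_openP => eps.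
  exact: (ringed_neq0 A (oV eps) (fV eps)).
- move=> V f /toric_openP oV /toric_regP fV; apply/toric_regP => eps.
  exact: (ringedV A (oV eps) (fV eps)).
Qed.

End ToricCharts.

(** * Smoothness *)

Section ToricSmooth.
Variables (K : fieldType) (r : nat) (b : 'I_r -> 'I_r -> int).
(** The form in which an infinite ground field enters: questions of density and uniqueness are
    restricted to lines, where they concern polynomials in one variable. *)
Hypothesis poly_inj : forall P : {poly K}, (forall t, P.[t] = 0) -> P = 0.
Implicit Types (eps del : 'I_r -> bool) (x y d : 'rV[K]_r) (m : 'rV[int]_r).
Local Notation X := (toric_variety K (limit_fan b)).
Local Notation phi := (@phi K r b).
Implicit Types (p q : X) (f : X -> K).
Let rX : ringed X := toric_ringed K b.

Definition chart_dom eps : set X := range (phi eps).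

(** Inverse of [phi eps] on its image; the value 0 elsewhere is a default. *)
Definition chart_coord eps p : 'rV[K]_r := xget 0 [set x | phi eps x = p].

Definition coord_fun eps (j : 'I_r) p : K := chart_coord eps p ord0 j.

Lemma phiK eps : cancel (phi eps) (chart_coord eps).
Proof.
move=> x; apply: (@phi_inj _ _ b eps).
exact: (@xgetPex _ 0 [set y | phi eps y = phi eps x] (ex_intro _ x erefl)).
Qed.

Lemma chart_coordK eps p : chart_dom eps p -> phi eps (chart_coord eps p) = p.
Proof. by move=> [x _ <-]; rewrite phiK. Qed.

Lemma chart_dom_phi eps x : chart_dom eps (phi eps x).
Proof. by exists x. Qed.

Lemma chart_domP eps del y :
  chart_dom eps (phi del y) <-> (forall j, del j != eps j -> y ord0 j != 0).
Proof.
split=> [[x _ /esym/phi_eq[]]//|y0].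
exists (\row_j mon b del y (dual_basis b eps j)) => //.
by apply/esym/phi_eq; split=> // j; rewrite mxE.
Qed.

Lemma coord_fun_phi eps del y j : chart_dom eps (phi del y) ->
  coord_fun eps j (phi del y) = mon b del y (dual_basis b eps j).
Proof. by move=> /chart_coordK/esym/phi_eq[_ e]; rewrite /coord_fun e. Qed.

Lemma chart_dom_open eps : sopen (chart_dom eps).
Proof.
apply/toric_openP => del y /chart_domP y0.
exists (fun z => \prod_(j | del j != eps j) z ord0 j); split.
- by apply: polyfun_prod => j _; exact: polyfun_coord.
- by apply/prodf_neq0 => j /y0.
- by move=> z /prodf_neq0 z0; apply/chart_domP => j /z0.
Qed.

Lemma ex_eq eps del m i : eps i = del i -> ex b eps m i = ex b del m i.
Proof. by move=> e; rewrite -!pairing_ray e. Qed.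

Lemma coord_fun_reg eps j : sreg (chart_dom eps) (coord_fun eps j).
Proof.
apply/toric_regP => del y yU; pose a i := ex b del (dual_basis b eps j) i.
exists (fun z => \prod_(i | 0 <= a i) z ord0 i ^+ `|a i|%N),
  (fun z => \prod_(i | ~~ (0 <= a i)) z ord0 i ^+ `|a i|%N); split.
- by apply: polyfun_prod => i _; apply: polyfunX; exact: polyfun_coord.
- by apply: polyfun_prod => i _; apply: polyfunX; exact: polyfun_coord.
(* At an index where the signs agree the exponent is 0 or 1. Hence the denominator contains only
   coordinates that are invertible on the overlap. *)
- apply/prodf_neq0 => i ai; apply: expf_neq0.
  move/chart_domP: yU; apply; apply: contraNneq ai => e.
  by rewrite /a (ex_eq _ e) ex_dual_basis; case: eqP.
- move=> z zU _; rewrite /= coord_fun_phi //.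
  rewrite /mon (bigID (fun i => 0 <= a i)) /= -prodfV; congr (_ * _).
    by apply: eq_bigr => i; rewrite -/(a i); case: (a i).
  by apply: eq_bigr => i; rewrite -/(a i); case: (a i).
Qed.

Lemma germ_coord eps p j : chart_dom eps p -> germ p (coord_fun eps j).
Proof. by move=> pU; exact: (germ_reg (@chart_dom_open eps) (@coord_fun_reg eps j) pU). Qed.

Lemma polyfun_chart_germ eps p (P : 'rV[K]_r -> K) : chart_dom eps p -> polyfun P ->
  germ p (fun q => P (chart_coord eps q)).
Proof. by move=> pU PP; apply: polyfun_germ => // j; exact: germ_coord. Qed.

Lemma near_phi eps x (Q : X -> Prop) : near (phi eps x) Q ->
  exists g, [/\ polyfun g, g x != 0 & forall y, g y != 0 -> Q (phi eps y)].
Proof.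
move=> [V [oV Vx VQ]]; have [g [Pg gx Vg]] := phi_open oV Vx.
by exists g; split=> // y /Vg /VQ.
Qed.

Lemma germ_phi eps x f : germ (phi eps x) f ->
  exists a g, [/\ polyfun a, polyfun g, g x != 0 &
    forall y, g y != 0 -> f (phi eps y) = a y / g y].
Proof.
move=> [V [oV Vx fV]]; have [g [Pg gx Vg]] := phi_open oV Vx.
have [a [h [Pa Ph hx fE]]] := phi_reg fV Vx.
exists (fun y => a y * g y), (fun y => h y * g y); split; try exact: polyfunM.
  by rewrite mulf_neq0.
move=> y; rewrite mulf_eq0 negb_or => /andP[hy gy].
have /= -> := fE y (Vg y gy) hy.
by field; rewrite gy hy.
Qed.

Lemma germ_chart eps p f : chart_dom eps p -> germ p f ->
  exists a g, [/\ polyfun a, polyfun g & near p (fun q =>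
    [/\ chart_dom eps q, g (chart_coord eps q) != 0 &
        a (chart_coord eps q) = f q * g (chart_coord eps q)])].
Proof.
move=> [x _ <-] /germ_phi[a [g [Pa Pg gx fE]]].
have pU := chart_dom_phi eps x.
exists a, g; split=> //; apply: nearW (nearI rX (near_open (@chart_dom_open eps) pU)
  (germ_neq0 rX (polyfun_chart_germ pU Pg) _)) => [q [qU gq]|]; last by rewrite phiK.
split=> //; have /fE := gq; rewrite chart_coordK // => ->.
by rewrite divfK.
Qed.

(** The coefficients are polynomials independent of the point, which later makes the entries of
    Jacobians regular. *)
Lemma polyfun_diff eps (P : 'rV[K]_r -> K) : polyfun P ->
  exists D : 'I_r -> 'rV[K]_r -> K, (forall j, polyfun (D j)) /\
    forall p, chart_dom eps p ->
      differential_at (coord_fun eps) p (fun q => P (chart_coord eps q))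
        (fun j => D j (chart_coord eps p)).
Proof.
pose Q P := exists D : 'I_r -> 'rV[K]_r -> K, (forall j, polyfun (D j)) /\
    forall p, chart_dom eps p ->
      differential_at (coord_fun eps) p (fun q => P (chart_coord eps q))
        (fun j => D j (chart_coord eps p)).
(* The product rule needs both factors to be germs, so the induction also carries [polyfun]. *)
move=> PP; suff [] : polyfun P /\ Q P by [].
move: P PP; apply: polyfun_ind => [f g [Pf [D [PD Df]]] fg|c|j|f g|f g].
- split; first exact: eq_polyfun fg.
  exists D; split=> // p pU.
  by apply: (diff_ext rX (Df p pU)) => // q; rewrite fg.
- split; first exact: polyfun_cst.
  exists (fun _ _ => 0); split=> [j|p _]; first exact: polyfun_cst.
  exact: diff_cst.
- split; first exact: polyfun_coord.
  exists (fun k _ => (k == j)%:R); split=> [k|p _]; first exact: polyfun_cst.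
  exact: diff_coord.
- move=> [Pf [D [PD Df]]] [Pg [E [PE Eg]]]; split; first exact: polyfunD.
  exists (fun j y => D j y + E j y); split=> [j|p pU]; first exact: polyfunD.
  exact: diffD (Df p pU) (Eg p pU).
- move=> [Pf [D [PD Df]]] [Pg [E [PE Eg]]]; split; first exact: polyfunM.
  exists (fun j y => f y * E j y + g y * D j y); split=> [j|p pU].
    by apply: polyfunD; apply: polyfunM.
  by apply: (diffM rX _ _ (Df p pU) (Eg p pU)); exact: polyfun_chart_germ.
Qed.

Lemma near_near p (Q : X -> Prop) : near p Q -> near p (fun q => near q Q).
Proof. by move=> [V [oV Vp VQ]]; exists V; split=> // q Vq; exists V. Qed.

Lemma germ_diff eps p f : chart_dom eps p -> germ p f ->
  exists D : 'I_r -> X -> K, (forall j, germ p (D j)) /\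
    near p (fun q => differential_at (coord_fun eps) q f (D^~ q)).
Proof.
move=> pU fp; have [a [g [Pa Pg ag]]] := germ_chart pU fp.
have [Da [PDa Ea]] := polyfun_diff eps Pa; have [Dg [PDg Eg]] := polyfun_diff eps Pg.
have [W [_ Wp /(_ _ Wp)[_ gp _]]] := ag.
exists (fun j q => (Da j (chart_coord eps q) - f q * Dg j (chart_coord eps q))
  * (g (chart_coord eps q))^-1); split.
  move=> j; apply: (germM rX); last by apply: (germV rX) => //; exact: polyfun_chart_germ.
  by apply: (germB rX); [|apply: (germM rX)] => //; exact: polyfun_chart_germ.
apply: nearW (nearI rX (near_near ag) (germ_locally fp)) => q [agq fq].
have [W' [_ Wq /(_ _ Wq)[qU gq _]]] := agq.
apply: (diff_div rX fq _ gq _ (Ea q qU) (Eg q qU)); first exact: polyfun_chart_germ.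
by apply: nearW agq => q' [].
Qed.

(** * Restriction of germs to a line through a point of a chart *)

Section Lines.
Variables (eps : 'I_r -> bool) (x d : 'rV[K]_r).

Lemma polyfun_line (f : 'rV[K]_r -> K) : polyfun f ->
  exists P : {poly K}, forall t, f (x + t *: d) = P.[t].
Proof.
move: f; apply: polyfun_ind => [f g [P fP] fg|c|j|f g [P fP] [Q gQ]|f g [P fP] [Q gQ]].
- by exists P => t; rewrite -fg.
- by exists c%:P => t; rewrite hornerC.
- exists ((x ord0 j)%:P + 'X * (d ord0 j)%:P) => t.
  by rewrite !mxE hornerD hornerM hornerX !hornerC.
- by exists (P + Q) => t; rewrite hornerD fP gQ.
- by exists (P * Q) => t; rewrite hornerM fP gQ.
Qed.

Lemma near_line (Q : X -> Prop) : near (phi eps x) Q ->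
  exists G : {poly K}, G.[0] != 0 /\ forall t, G.[t] != 0 -> Q (phi eps (x + t *: d)).
Proof.
move=> /near_phi[g [Pg gx gQ]]; have [G GE] := polyfun_line Pg.
exists G; split=> [|t]; first by rewrite -GE scale0r addr0.
by rewrite -GE => /gQ.
Qed.

Lemma germ_line f : germ (phi eps x) f ->
  exists A G : {poly K}, G.[0] != 0 /\
    forall t, G.[t] != 0 -> f (phi eps (x + t *: d)) * G.[t] = A.[t].
Proof.
move=> /germ_phi[a [g [Pa Pg gx fE]]].
have [G GE] := polyfun_line Pg; have [A AE] := polyfun_line Pa.
exists A, G; split=> [|t]; first by rewrite -GE scale0r addr0.
by rewrite -GE => gt; rewrite fE // divfK // AE.
Qed.

(** Vanishing to order at least 2 at t = 0 for a fraction with denominator [G]; where [G] vanishes,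
    [u] may take arbitrary values. *)
Definition double_zero (u : K -> K) : Prop :=
  exists S G : {poly K}, G.[0] != 0 /\ forall t, G.[t] != 0 -> u t * G.[t] = t ^+ 2 * S.[t].

Lemma double_zeroD u v : double_zero u -> double_zero v ->
  double_zero (fun t => u t + v t).
Proof.
move=> [S [G [G0 uE]]] [T [H [H0 vE]]].
exists (S * H + T * G), (G * H); split=> [|t]; first by rewrite hornerM mulf_neq0.
rewrite hornerD !hornerM mulf_eq0 negb_or => /andP[Gt Ht].
transitivity (u t * G.[t] * H.[t] + v t * H.[t] * G.[t]); first by ring.
by rewrite uE // vE //; ring.
Qed.

Lemma double_zeroM f g : germ (phi eps x) f -> germ (phi eps x) g ->
  f (phi eps x) = 0 -> g (phi eps x) = 0 ->
  double_zero (fun t => f (phi eps (x + t *: d)) * g (phi eps (x + t *: d))).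
Proof.
have vanish h : germ (phi eps x) h -> h (phi eps x) = 0 ->
    exists A G : {poly K}, G.[0] != 0 /\
    forall t, G.[t] != 0 -> h (phi eps (x + t *: d)) * G.[t] = t * A.[t].
  move=> /germ_line[A [G [G0 hE]]] h0.
  have : root A 0 by rewrite /root -hE // scale0r addr0 h0 mul0r.
  move=> /factor_theorem[Q AE]; exists Q, G; split=> // t /hE ->.
  by rewrite AE hornerM hornerXsubC subr0 mulrC.
move=> /vanish fv /vanish gv /fv[A [G [G0 fE]]] /gv[B [H [H0 gE]]].
exists (A * B), (G * H); split=> [|t]; first by rewrite hornerM mulf_neq0.
rewrite !hornerM mulf_eq0 negb_or => /andP[Gt Ht].
rewrite mulrACA fE // gE //; ring.
Qed.

Lemma sqmax_line f : in_sqmax (phi eps x) f ->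
  double_zero (fun t => f (phi eps (x + t *: d))).
Proof.
move=> [V [N [a [c [oV Vx acV fE]]]]].
have [G [G0 GV]] := near_line (near_open oV Vx).
have : double_zero (fun t => \sum_(i < N)
    a i (phi eps (x + t *: d)) * c i (phi eps (x + t *: d))).
  elim: (index_enum _) => [|i s [S [H [H0 IH]]]].
    by exists 0, 1; split=> [|t _]; rewrite hornerC ?oner_eq0 // big_nil hornerC mulr0 mul0r.
  have [aV cV a0 c0] := acV i.
  have ai : germ (phi eps x) (a i) by exists V.
  have ci : germ (phi eps x) (c i) by exists V.
  have [T [H' [H0' E]]] := double_zeroD (double_zeroM ai ci a0 c0)
    (ex_intro _ S (ex_intro _ H (conj H0 IH))).
  by exists T, H'; split=> // t /E; rewrite big_cons.
move=> [S [H [H0 E]]]; exists (S * G), (G * H).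
split=> [|t]; first by rewrite hornerM mulf_neq0.
rewrite !hornerM mulf_eq0 negb_or => /andP[/GV/fE -> /E] e.
rewrite mulrCA e; ring.
Qed.

(** The polynomial G X (c G - X S) vanishes at every t, the factor [G] covering the parameters
    without information. Cancel G X and evaluate at 0. *)
Lemma linear_double_zero (c : K) : double_zero (fun t => t * c) -> c = 0.
Proof.
move=> [S [G [G0 E]]].
have GX0 : G * 'X != 0.
  by rewrite mulf_neq0 ?polyX_eq0 //; apply: contraNneq G0 => ->; rewrite horner0.
have : G * 'X * (c *: G - 'X * S) = 0.
  apply: poly_inj => t; rewrite !(hornerD, hornerN, hornerM, hornerX, hornerZ).
  have [->|Gt] := eqVneq G.[t] 0; first by rewrite !mul0r.
  rewrite -mulrA mulrBr mulrA (E t Gt) expr2 -mulrA subrr mulr0 //.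
move/eqP; rewrite mulf_eq0 (negPf GX0) subr_eq0 /= => /eqP/(congr1 (horner^~ 0)).
rewrite hornerZ hornerM hornerX mul0r => /eqP.
by rewrite mulf_eq0 (negPf G0) orbF => /eqP.
Qed.

End Lines.

(** The difference of the two expansions is a linear form in the square of the maximal ideal. Along
    the j-th coordinate line it becomes t (c_j - c'_j), which has a double zero only if it is 0. *)
Lemma diff_uniq eps p f c c' : chart_dom eps p ->
  differential_at (coord_fun eps) p f c -> differential_at (coord_fun eps) p f c' ->
  c =1 c'.
Proof.
move=> [x _ <-] fc fc' j; apply/eqP; rewrite -subr_eq0; apply/eqP.
have := sqmaxD rX fc' (sqmaxM rX (germ_cst rX _ (-1)) fc).
move=> /(sqmax_line (delta_mx ord0 j)) [S [G [G0 E]]].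
apply: linear_double_zero; exists S, G; split=> // t /E <-; congr (_ * _).
have sumE (e : 'I_r -> K) : \sum_i e i * (coord_fun eps i (phi eps (x + t *: delta_mx ord0 j))
    - coord_fun eps i (phi eps x)) = t * e j.
  rewrite (bigD1 j) //= /coord_fun !phiK !mxE !eqxx mulr1 addrAC subrr add0r mulrC.
  rewrite big1 ?addr0 // => i ij.
  by rewrite !mxE eqxx (negPf ij) mulr0 addr0 subrr mulr0.
rewrite !sumE; ring.
Qed.

Lemma coord_fun_basis eps p : chart_dom eps p -> forall f, germ p f ->
  exists! c : 'rV[K]_r, differential_at (coord_fun eps) p f (c ord0).
Proof.
move=> pU f fp; have [D [_ [W [_ Wp /(_ _ Wp) fD]]]] := germ_diff pU fp.
exists (\row_j D j p); split=> [|c fc].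
  by apply: (diff_ext rX fD) => // j; rewrite mxE.
by apply/rowP => j; rewrite mxE; exact: diff_uniq pU fD fc j.
Qed.

Definition chart_coords eps : coords X r :=
  Coords (@chart_dom_open eps) (@coord_fun_reg eps) (@coord_fun_basis eps).

Lemma toric_smooth : smooth X r.
Proof.
by move=> p; have [eps [x ->]] := phi_surj p; exists (chart_coords eps); exact: chart_dom_phi.
Qed.

Definition torus eps q : Prop := exists2 y : 'rV[K]_r, (forall j, y ord0 j != 0) & q = phi eps y.

(** The line through the point in direction (1, ..., 1) leaves the torus at finitely many parameters
    only, the roots of [P]. Along it the numerator [A] of [f] is killed by a nonzero polynomial,
    hence is 0. *)
Lemma torus_dense eps p f : chart_dom eps p -> germ p f ->
  near p (fun q => torus eps q -> f q = 0) -> f p = 0.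
Proof.
move=> [x _ <-] fp f0; pose d : 'rV[K]_r := const_mx 1.
have [A [G [G0 fE]]] := germ_line d fp; have [H [H0 HE]] := near_line d f0.
pose P := \prod_j ('X + (x ord0 j)%:P).
have P0 : P != 0 by apply/prodf_neq0 => j _; rewrite monic_neq0 ?monicXaddC.
have GH0 : G * H * P != 0.
  by rewrite !mulf_neq0 //; [apply: contraNneq G0|apply: contraNneq H0] => ->; rewrite horner0.
have : G * H * P * A = 0.
  apply: poly_inj => t; rewrite !hornerM.
  have [->|Gt] := eqVneq G.[t] 0; first by rewrite !mul0r.
  have [->|Ht] := eqVneq H.[t] 0; first by rewrite mulr0 !mul0r.
  have [->|Pt] := eqVneq P.[t] 0; first by rewrite mulr0 mul0r.
  rewrite -fE // HE ?mul0r ?mulr0 //; exists (x + t *: d) => // j.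
  move: Pt; rewrite horner_prod => /prodf_neq0/(_ j isT).
  by rewrite hornerD hornerX hornerC !mxE mulr1 addrC.
move/eqP; rewrite mulf_eq0 (negPf GH0) /= => /eqP A0.
have := fE 0 G0; rewrite A0 horner0 scale0r addr0 => /eqP.
by rewrite mulf_eq0 (negPf G0) orbF => /eqP.
Qed.

End ToricSmooth.

(** * Sections of the anticanonical bundle *)

Section ToricSections.
Variables (K : fieldType) (r : nat) (b : 'I_r -> 'I_r -> int).
Hypothesis poly_inj : forall P : {poly K}, (forall t, P.[t] = 0) -> P = 0.
Implicit Types (eps del : 'I_r -> bool) (x y : 'rV[K]_r) (m : 'rV[int]_r).
Local Notation X := (toric_variety K (limit_fan b)).
Local Notation phi := (@phi K r b).
Local Notation C := (chart_coords b poly_inj).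
Local Notation ex := (ex b).
Local Notation mon := (mon b).
Local Notation rays := (rays b).
Implicit Types (p q : X) (f g : X -> K) (t : coords X r).
Let rX : ringed X := toric_ringed K b.

Section LogDifferential.
Variables (phi : 'I_r -> X -> K) (q : X).

(** Here [c] lists the coefficients of df / f. Logarithmic differentials turn monomials into linear
    combinations of exponents. *)
Definition logdiff f (c : 'I_r -> K) : Prop :=
  [/\ germ q f, f q != 0 & differential_at phi q f (fun j => f q * c j)].

Lemma logdiff1 : logdiff (fun=> 1) (fun=> 0).
Proof.
split; [exact: germ_cst|exact: oner_neq0|].
by apply: (diff_ext rX (diff_cst rX phi q 1)) => // j; rewrite mulr0.
Qed.

Lemma logdiffM f g c d : logdiff f c -> logdiff g d ->
  logdiff (fun p => f p * g p) (fun j => c j + d j).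
Proof.
move=> [fq f0 fc] [gq g0 gd]; split; [exact: germM|exact: mulf_neq0|].
by apply: (diff_ext rX (diffM rX fq gq fc gd)) => // j; ring.
Qed.

Lemma logdiffV f c : logdiff f c -> logdiff (fun p => (f p)^-1) (fun j => - c j).
Proof.
move=> [fq f0 fc]; split; [exact: germV|by rewrite invr_eq0|].
have fV : near q (fun p => 1 = (f p)^-1 * f p).
  by apply: nearW (germ_neq0 rX fq f0) => p fp; rewrite mulVf.
have d := diff_div rX (germV rX fq f0) fq f0 fV (diff_cst rX phi q 1) fc.
by apply: (diff_ext rX d) => // j; field.
Qed.

Lemma logdiffX f c n : logdiff f c -> logdiff (fun p => f p ^+ n) (fun j => n%:R * c j).
Proof.
move=> fc; elim: n => [|n IH].
  by have := logdiff1; congr logdiff; apply/funext => j; rewrite mul0r.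
have := logdiffM fc IH; congr logdiff; first by apply/funext => p; rewrite exprS.
by apply/funext => j; rewrite mulrS mulrDl mul1r.
Qed.

Lemma logdiffXz f c (z : int) : logdiff f c ->
  logdiff (fun p => f p ^ z) (fun j => z%:~R * c j).
Proof.
case: z => n fc; first exact: logdiffX.
have := logdiffV (logdiffX n.+1 fc); congr logdiff.
by apply/funext => j; rewrite NegzE mulrNz mulNr.
Qed.

Lemma logdiff_prod I (s : seq I) (f : I -> X -> K) (c : I -> 'I_r -> K) :
  (forall i, logdiff (f i) (c i)) ->
  logdiff (fun p => \prod_(i <- s) f i p) (fun j => \sum_(i <- s) c i j).
Proof.
move=> fc; elim: s => [|i s IH].
  by have := logdiff1; congr logdiff; apply/funext => p; rewrite big_nil.
by have := logdiffM (fc i) IH; congr logdiff; apply/funext => p; rewrite big_cons.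
Qed.

End LogDifferential.

Lemma jacobian_torus eps del y q : phi eps y = q -> (forall j, y ord0 j != 0) ->
  chart_dom del q -> forall i j, jacobian (C del) (C eps) q i j =
    coord_fun del i q * (ex eps (dual_basis b del i) j)%:~R * (y ord0 j)^-1.
Proof.
move=> <- y0 qU i j; pose e k := ex eps (dual_basis b del i) k.
have qE := chart_dom_phi b eps y.
have ld (k : 'I_r) : logdiff (coord_fun eps) (phi eps y) (coord_fun (b := b) eps k)
    (fun l => (l == k)%:R / y ord0 k).
  split; [exact: germ_coord|by rewrite /coord_fun phiK|].
  apply: (diff_ext rX (diff_coord rX _ _ k)) => // l.
  by rewrite /coord_fun phiK mulrCA divff ?mulr1.
have [_ _ d] := logdiff_prod (index_enum 'I_r) (fun k => logdiffXz (e k) (ld k)).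
have mE p : chart_dom eps p -> chart_dom del p ->
    coord_fun del i p = \prod_k coord_fun eps k p ^ e k.
  by move=> [z _ <-] pU; rewrite coord_fun_phi //; apply: eq_bigr => k _; rewrite /coord_fun phiK.
have {}d : differential_at (cfun (C eps)) (phi eps y) (cfun (C del) i)
    (fun j => coord_fun del i (phi eps y) * (e j)%:~R * (y ord0 j)^-1).
  apply: (diff_ext rX (diff_near rX d _)) => //; last first.
    move=> l /=; rewrite -mE // -mulrA; congr (_ * _).
    rewrite (bigD1 l) //= eqxx mul1r big1 ?addr0 // => k kl.
    by rewrite eq_sym (negPf kl) mul0r mulr0.
  apply: nearW (nearI rX (near_open (@chart_dom_open _ _ b eps) qE)
    (near_open (@chart_dom_open _ _ b del) qU)) => p [pE pD].
  exact: mE.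
exact: (jacobian_uniq rX (x := C del) (y := C eps) qU qE d).
Qed.

(* The coordinate of [chi^m (d_1 /\ ... /\ d_r)^k] in the frame of [t], computed
   in the chart of [eps]. *)
Definition local_section eps (k : nat) m t p : K :=
  (\det (jacobian t (C eps) p) * (\det (rays eps))%:~R) ^+ k
  * \prod_j coord_fun eps j p ^+ absz (ex eps m j + k%:Z).

(* [m] is a lattice point of the polytope of the k-th power of the
   anticanonical bundle. *)
Definition admissible (k : nat) m : Prop :=
  forall u, - k%:Z <= pairing m (limit_ray b u).

Lemma admissible_ge0 k m eps j : admissible k m -> 0 <= ex eps m j + k%:Z.
Proof. by move=> /(_ (eps j, j)); rewrite pairing_ray -lerBlDr sub0r. Qed.

(** [jacobian] is chosen point by point; by uniqueness it agrees near [p] with the regular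
    coefficients of [germ_diff]. *)
Lemma jacobian_germ t eps p i j : cdom t p -> chart_dom eps p ->
  germ p (fun q => jacobian t (C eps) q i j).
Proof.
move=> tp pU; have [D [Dp nD]] := germ_diff pU (germ_cfun i tp).
apply: (germ_near rX (Dp j)).
apply: nearW (nearI rX nD (nearI rX (near_open (cdom_open t) tp)
  (near_open (@chart_dom_open _ _ b eps) pU))) => q [dq [tq qU]].
exact: (jacobian_uniq rX (y := C eps) tq qU dq).
Qed.

Lemma local_section_germ eps k m t p : cdom t p -> chart_dom eps p ->
  germ p (local_section eps k m t).
Proof.
move=> tp pU; apply: (germM rX).
  apply: (germX rX); apply: (germM rX); last exact: germ_cst.
  have := germ_det rX (fun i j => jacobian_germ i j tp pU).
  by congr germ; apply/funext => q; congr (\det _); apply/matrixP => i j; rewrite mxE.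
apply: (germ_prod rX) => j; apply: (germX rX); exact: germ_coord.
Qed.

Lemma det_rays_sqrK eps : (\det (rays eps))%:~R * (\det (rays eps))%:~R = 1 :> K.
Proof. by rewrite -intrM det_rays_sqr. Qed.

Lemma det_rays_neq0 eps : (\det (rays eps))%:~R != 0 :> K.
Proof.
apply: contra_eq_neq (det_rays_sqrK eps) => ->.
by rewrite mul0r eq_sym oner_eq0.
Qed.

(** Admissibility makes the absolute values in the exponents harmless; on the torus the character
    [m] then splits off from the k-th power. *)
Lemma local_section_torus eps k m t y : admissible k m ->
  (forall j, y ord0 j != 0) ->
  local_section eps k m t (phi eps y) =
  (\det (jacobian t (C eps) (phi eps y)) * (\det (rays eps))%:~R * \prod_j y ord0 j) ^+ k
  * mon eps y m.
Proof.
move=> am y0; rewrite /local_section [in RHS]exprMn -mulrA; congr (_ * _).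
rewrite -prodrXl -big_split; apply: eq_bigr => j _ /=.
rewrite /coord_fun phiK; transitivity (y ord0 j ^ (ex eps m j + k%:Z)).
  by rewrite -{2}(gez0_abs (admissible_ge0 eps j am)).
by rewrite expfzDr // mulrC.
Qed.

(** Chart independence of d_1 /\ ... /\ d_r. The Jacobian of a monomial change of charts is the
    integral matrix of exponents between two diagonal matrices of coordinates, so its determinant
    splits into signs and products of coordinates. *)
Lemma det_jacobian_torus eps del y : (forall j, y ord0 j != 0) ->
  chart_dom del (phi eps y) ->
  \det (jacobian (C del) (C eps) (phi eps y)) * (\det (rays eps))%:~R * \prod_j y ord0 j =
  (\det (rays del))%:~R * \prod_j coord_fun del j (phi eps y).
Proof.
move=> y0 qU; pose z := chart_coord del (phi eps y).
have -> : jacobian (C del) (C eps) (phi eps y) =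
    diag_mx z *m map_mx intr (invmx (rays del) *m rays eps)
      *m diag_mx (\row_j (y ord0 j)^-1).
  apply/matrixP => i j; rewrite (jacobian_torus erefl y0 qU).
  by rewrite mul_mx_diag mul_diag_mx !mxE /ex /dual_basis -row_mul !mxE.
rewrite !det_mulmx !det_diag det_map_mx det_mulmx rmorphM /=.
have dV : \det (invmx (rays del)) = \det (rays del).
  have u := rays_unit b del; rewrite unitmxE in u.
  apply: (mulrI u); rewrite det_rays_sqr -det_mulmx mulmxV ?det1 //.
rewrite dV; set P := \prod_j z ord0 j; set Q := \prod_j y ord0 j.
have -> : \prod_j (\row_j (y ord0 j)^-1) ord0 j = Q^-1.
  by rewrite -prodfV; apply: eq_bigr => j _; rewrite mxE.
have Q0 : Q != 0 by apply/prodf_neq0.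
transitivity ((\det (rays del))%:~R * P
  * ((\det (rays eps))%:~R * (\det (rays eps))%:~R) * (Q^-1 * Q)); first by ring.
by rewrite det_rays_sqrK mulVf // !mulr1.
Qed.

(** Both sides are germs, so by [torus_dense] it suffices to compare them on the torus, where the
    monomial formulas apply. *)
Lemma local_section_eq eps del k m t p : admissible k m -> cdom t p ->
  chart_dom eps p -> chart_dom del p ->
  local_section eps k m t p = local_section del k m t p.
Proof.
move=> am tp pE pD; apply/eqP; rewrite -subr_eq0; apply/eqP.
have g : germ p (fun q => local_section eps k m t q - local_section del k m t q).
  by apply: germB => //; exact: local_section_germ.
apply: (torus_dense poly_inj pE g).
apply: nearW (nearI rX (near_open (cdom_open t) tp)
  (near_open (@chart_dom_open _ _ b del) pD)) => q [tq qD] [y y0 qy].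
apply/eqP; rewrite subr_eq0; apply/eqP; rewrite {}qy in tq qD *.
have qE := chart_dom_phi b eps y.
have zE := chart_coordK qD; set z := chart_coord del _ in zE.
have z0 j : z ord0 j != 0.
  have -> : z ord0 j = coord_fun del j (phi eps y) by [].
  rewrite coord_fun_phi //; apply/prodf_neq0 => i _; exact: expfz_neq0.
rewrite local_section_torus // -[in RHS]zE local_section_torus // zE.
rewrite (mon_phi_eq m (esym zE) y0); congr (_ ^+ _ * _).
rewrite (jacobianM rX (y := C del) (z := C eps) tq qD qE) det_mulmx -!mulrA.
congr (_ * _); rewrite mulrA det_jacobian_torus //.
Qed.

(** An arbitrary chart around [p]; for admissible characters [local_section_eq] makes the choice
    immaterial. *)
Definition chart_of p : 'I_r -> bool := projT1 (cid (phi_surj p)).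

Lemma chart_of_dom p : chart_dom (chart_of p) p.
Proof. by rewrite /chart_of; case: cid => eps /= [x ->]; exact: chart_dom_phi. Qed.

Definition char_section (k : nat) m t p : K := local_section (chart_of p) k m t p.

Lemma char_sectionE eps k m t p : admissible k m -> cdom t p -> chart_dom eps p ->
  char_section k m t p = local_section eps k m t p.
Proof. by move=> am tp pE; apply: local_section_eq => //; exact: chart_of_dom. Qed.

Lemma char_section_is_section k m : admissible k m ->
  @is_section K X (lb_pow (anticanonical_bundle X r) k) setT (char_section k m).
Proof.
move=> am; split=> [t|t t' p _ tp t'p].
  apply: (reg_germ rX) => p [_ tp]; have pU := chart_of_dom p.
  apply: (germ_near rX (local_section_germ k m tp pU)).
  apply: nearW (nearI rX (near_open (cdom_open t) tp)
    (near_open (@chart_dom_open _ _ b _) pU)) => q [tq qU].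
  exact: char_sectionE.
have pU := chart_of_dom p; rewrite /char_section /local_section /= mulrA -exprMn mulrA.
congr ((_ * _) ^+ _ * _).
rewrite (jacobianM rX (x := t) (y := t') (z := C (chart_of p)) tp t'p pU) det_mulmx; congr (_ * _).
(* The anticanonical transition function is the inverse determinant of [jacobian t' t], which equals
   the determinant of [jacobian t t']. *)
rewrite -[RHS]mul1r -(det_jacobianV rX tp t'p) mulfK //.
exact: (det_jacobian_neq0 rX).
Qed.

Lemma char_section_neq0 eps k m x t : admissible k m -> cdom t (phi eps x) ->
  (char_section k m t (phi eps x) != 0) =
  [forall j, x ord0 j ^+ absz (ex eps m j + k%:Z) != 0].
Proof.
move=> am tp; have pU := chart_dom_phi b eps x.
rewrite (char_sectionE am tp pU) mulf_eq0 negb_or expf_neq0 /=; last first.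
  rewrite mulf_neq0 ?det_rays_neq0 //.
  exact: (det_jacobian_neq0 rX (y := C eps)).
apply/prodf_neq0/forallP => x0 j; last by rewrite /coord_fun phiK.
by have := x0 j isT; rewrite /coord_fun phiK.
Qed.

Lemma nonvanishing_char_section eps k m x : admissible k m ->
  @nonvanishing K X (lb_pow (anticanonical_bundle X r) k) (char_section k m) (phi eps x) <->
  (forall j, x ord0 j ^+ absz (ex eps m j + k%:Z) != 0).
Proof.
move=> am; split=> [[t tp] |x0].
  by rewrite (char_section_neq0 am tp) => /forallP.
exists (C eps); first exact: chart_dom_phi.
by rewrite char_section_neq0 //; [apply/forallP|exact: chart_dom_phi].
Qed.

End ToricSections.

(** * Nefness and ampleness *)

Section ColengthOne.
Variables (K : fieldType) (Y : space K) (p : Y).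
Hypothesis cstY : forall (V : set Y) (c : K), sreg V (fun=> c).
Hypothesis openT : sopen [set: Y].

(** Either the default 0 is returned, or a basis exists. In the latter case the quotient by a unit
    is zero, and a first basis element would have the two expansions 0 and itself, against
    uniqueness. *)
Lemma colength1 : colength p (fun=> 1 : K) = 0%N.
Proof.
rewrite /colength; case: xgetP => // d _ [e [ep eP]].
case: d e ep eP => // d e ep /(_ _ (ep ord0))[c [_ cu]].
have h0 : c = 0.
  apply: cu; exists (e ord0), setT; split=> // q _.
  by rewrite big1 ?add0r ?mul1r // => i _; rewrite mxE mul0r.
have h1 : c = delta_mx ord0 ord0.
  apply: cu; exists (fun=> 0), setT; split=> //; first by exists setT.
  move=> q _; rewrite (bigD1 ord0) //= mxE !eqxx mulr0 addr0 mul1r big1 ?addr0 // => i i0.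
  by rewrite mxE (negPf i0) mul0r.
have /matrixP/(_ ord0 ord0) : delta_mx ord0 ord0 = 0 :> 'rV[K]_d.+1 by rewrite -h1 h0.
by rewrite !mxE !eqxx => /eqP; rewrite oner_eq0.
Qed.

End ColengthOne.

(* A global section not vanishing identically on a curve has no poles there. *)
Lemma nef_globally_generated (K : fieldType) (X : space K) (L : line_bundle X) :
    ringed X -> (forall t : frame L, sopen (fdom t)) ->
    (forall p : X, exists t, fdom (l := L) t p) ->
    (forall p : X, exists s, @is_section K X L setT s /\ @nonvanishing K X L s p) ->
  nef L.
Proof.
move=> rX oL cL gL Z [_ [[z Zz] _] _ _].
have [s [[sreg_s sE] [t zt sz]]] := gL z.
pose Y := @Defs.subspace K X Z; pose s' (t : frame L) (q : Y) := s t (sval q).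
have regS (V : set X) (h : X -> K) : sopen V -> sreg V h ->
    @sreg K Y [set q | V (sval q)] (fun q => h (sval q)).
  by move=> oV hV q Vq; exists V, h; split.
have oT : @sopen K Y setT by exists setT; [exact: ringedT rX|].
have cstY (V : set Y) (c : K) : @sreg K Y V (fun=> c).
  move=> q _; exists setT, (fun=> c); split=> //; first exact: ringedT rX.
  exact: ringed_cst rX _ _.
have /choice[fr frP] : forall p : Y, exists t : frame L, fdom t (sval p).
  by move=> p; exact: cL.
pose m (p : Y) : int := (colength p (s' (fr p)))%:Z.
have fT (t' : frame L) : setT `&` fdom t' = fdom t' by rewrite setTI.
exists (\sum_(p \in [set: {classic Y}]) m p); split; last first.
  by apply: fsumr_ge0 => p _; exact: le0z_nat.
exists setT, s', m; split=> //.
- split=> [t'|t' t'' q _]; last exact: sE.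
  have := regS _ _ (oL t') _; rewrite setTI; apply.
  by rewrite -fT; exact: sreg_s.
- by exists (exist _ z Zz) => //; exists t.
- move=> p; exists (fr p), [set q | fdom (fr p) (sval q)], (s' (fr p)), (fun=> 1).
  split.
  + exact: frP.
  + by split; [exists (fdom (fr p)); [exact: oL|]|exact: frP].
  + by split=> //; apply: regS => //; rewrite -fT; exact: sreg_s.
  + by exists p; [exact: frP|exact: oner_neq0].
  + by split=> [q _ _ _|]; rewrite ?mulr1 // colength1 // subr0.
Qed.

Section Positivity.
Variables (K : fieldType) (r : nat) (b : 'I_r -> 'I_r -> int).
Hypothesis poly_inj : forall P : {poly K}, (forall t, P.[t] = 0) -> P = 0.
Implicit Types (eps del : 'I_r -> bool) (x y : 'rV[K]_r) (m : 'rV[int]_r).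
Local Notation X := (toric_variety K (limit_fan b)).
Local Notation phi := (@phi K r b).
Local Notation ex := (ex b).
Let rX : ringed X := toric_ringed K b.

(** [phi eps] and [chart_coord eps] are inverse isomorphisms between the chart and K^r, taken as a
    closed subset of itself. *)
Lemma chart_dom_affine eps : affine (subspace (chart_dom (K := K) (b := b) eps)).
Proof.
exists r, setT; split; first by rewrite /sclosed setCT; exact: (fun p => False_ind _).
pose U := chart_dom (K := K) (b := b) eps.
exists (fun p : {p : X | U p} => exist (fun=> True) (chart_coord eps (sval p)) I).
exists (fun x : {x : 'rV[K]_r | True} =>
  exist U (phi eps (sval x)) (chart_dom_phi b eps (sval x))).
have oU := @chart_dom_open K r b eps.
split.
- by move=> [p pU]; apply: eq_exist; exact: chart_coordK.
- by move=> [x xT]; apply: eq_exist; exact: phiK.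
- split=> [_ [V oV ->]|_ h [V oV ->] hV].
    exists [set p | U p /\ V (chart_coord eps p)]; last first.
      by apply/seteqP; split=> [[p pU]|[p pU]] //= [].
    apply: (sopen_near rX) => p [pU /oV[g [Pg gp gV]]].
    apply: nearW (nearI rX (near_open oU pU)
      (germ_neq0 rX (polyfun_chart_germ pU Pg) gp)) => q [qU gq].
    by split=> //; exact: gV.
  move=> [p pU] /= Vp; have [W [g [oW gW Wp hg]]] := hV (exist _ (chart_coord eps p) I) Vp.
  have [a [c [Pa Pc cp gE]]] := gW _ Wp.
  have [e [Pe ep eW]] := oW _ Wp.
  have ng : near p (fun q => [/\ U q, c (chart_coord eps q) != 0 & e (chart_coord eps q) != 0]).
    apply: nearW (nearI rX (near_open oU pU) (nearI rX
      (germ_neq0 rX (polyfun_chart_germ pU Pc) cp)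
      (germ_neq0 rX (polyfun_chart_germ pU Pe) ep))) => q [? []]; by split.
  have gp : germ p (fun q => a (chart_coord eps q) * (c (chart_coord eps q))^-1).
    by apply: (germM rX); [|apply: (germV rX) => //]; exact: polyfun_chart_germ.
  have gp' : germ p (fun q => g (chart_coord eps q)).
    apply: (germ_near rX gp); apply: nearW ng => q [qU cq /eW Wq].
    exact: gE.
  have [W1 [oW1 W1p W1P]] := ng; have [W2 [oW2 W2p gW2]] := gp'.
  have rW : @sreg K X (W1 `&` W2) (fun q => g (chart_coord eps q)).
    by apply: (reg_germ rX) => q [_ W2q]; exists W2.
  exists (W1 `&` W2), (fun q => g (chart_coord eps q)); split=> //.
  + exact: (ringedI rX).
  + move=> [q qU] /= Vq [/W1P[_ _ /eW Wq] _].
    exact: (hg (exist _ (chart_coord eps q) I)).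
- split=> [_ [V oV ->]|_ h [V oV ->] hV].
    exists (phi eps @^-1` V); first exact: phi_open.
    by apply/seteqP; split.
  move=> [x xT] /= Vx.
  have [W [g [oW gW Wx hg]]] := hV (exist _ (phi eps x) (chart_dom_phi b eps x)) Vx.
  exists (phi eps @^-1` W), (g \o phi eps); split=> //; first exact: phi_open.
    exact: phi_reg.
  by move=> [y yT] /= Vy Wy; exact: (hg (exist _ (phi eps y) (chart_dom_phi b eps y))).
Qed.

(* The vertex of the anticanonical polytope dual to the cone [max_cone eps]. *)
Definition vertex eps : 'rV[int]_r := const_mx (-1) *m invmx (rays b eps).

Lemma ex_vertex eps j : ex eps (vertex eps) j = -1.
Proof. by rewrite /ex /vertex mulmxKV ?rays_unit // mxE. Qed.

Local Notation L := (anticanonical_bundle X r).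

Lemma toric_nef : (forall eps, admissible b 1 (vertex eps)) -> nef L.
Proof.
move=> am; apply: nef_globally_generated => //.
- by move=> t; exact: cdom_open.
- by move=> p; exact: toric_smooth poly_inj p.
- move=> p; have [eps [x ->]] := phi_surj p.
  exists (char_section poly_inj 1 (vertex eps)); split.
    exact: (char_section_is_section poly_inj (am eps)).
  apply/(nonvanishing_char_section poly_inj eps x (am eps)) => j.
  by rewrite ex_vertex addNr expr0 oner_eq0.
Qed.

Lemma toric_ample : (forall eps j, 0 <= pairing (vertex eps) (limit_ray b (~~ eps j, j))) ->
  ample L.
Proof.
move=> vP p.
have am eps : admissible b 1 (vertex eps).
  move=> [e j]; have [->|ne] := eqVneq e (eps j); first by rewrite pairing_ray ex_vertex.
  have -> : e = ~~ eps j by case: e (eps j) ne => [] [].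
  exact: le_trans (vP eps j).
have [eps [x pE]] := phi_surj p.
exists 1%N, (char_section poly_inj 1 (vertex eps)).
(* In the chart of [del] the exponent is 0 where the signs agree and at least 1 where they differ.
   Non-vanishing is thus the condition of [chart_domP] for lying in the chart of [eps]. *)
have nvE : @nonvanishing K X (lb_pow L 1) (char_section poly_inj 1 (vertex eps)) =
    chart_dom (K := K) (b := b) eps.
  apply/seteqP; split=> q; have [del [y ->]] := phi_surj q.
    move=> /(nonvanishing_char_section poly_inj del y (am eps)) y0.
    apply/chart_domP => j dj; apply: contra_neq (y0 j) => ->.
    have -> : ex del (vertex eps) j = pairing (vertex eps) (limit_ray b (~~ eps j, j)).
      rewrite -pairing_ray; congr (pairing _ (limit_ray _ (_, _))).
      by case: (del j) (eps j) dj => [] [].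
    have := vP eps j; case: (pairing _ _) => // n _.
    by rewrite -PoszD addn1 expr0n.
  move=> /chart_domP y0; apply/(nonvanishing_char_section poly_inj del y (am eps)) => j.
  have [dj|/y0/expf_neq0//] := eqVneq (del j) (eps j).
  by rewrite (ex_eq _ _ dj) ex_vertex addNr expr0 oner_eq0.
split=> //; first exact: char_section_is_section.
  by rewrite nvE pE; exact: chart_dom_phi.
by rewrite nvE; exact: chart_dom_affine.
Qed.

End Positivity.

(** * From conditions I and II to the position of the vertices *)

Section Combinatorics.
Variables (r : nat) (b : 'I_r -> 'I_r -> int).
Implicit Types (eps : 'I_r -> bool) (i j : 'I_r).

Lemma pairing_limit_ray_true (m : 'rV[int]_r) i : pairing m (limit_ray b (true, i)) = m ord0 i.
Proof.
rewrite /pairing (bigD1 i) //= mxE !eqxx mulr1 big1 ?addr0 // => j ij.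
by rewrite mxE (negPf ij) mulr0.
Qed.

Lemma pairing_limit_ray_false (m : 'rV[int]_r) i : pairing m (limit_ray b (false, i)) =
  - m ord0 i - \sum_(j < r | (i < j)%N) b i j * m ord0 j.
Proof.
rewrite -!pairing_limit_ray_true /pairing /=.
transitivity (\sum_k (- (m ord0 k * (delta_mx ord0 i : 'rV[int]_r) ord0 k)
  - \sum_(j < r | (i < j)%N) m ord0 k * (b i j * (delta_mx ord0 j : 'rV[int]_r) ord0 k))).
  apply: eq_bigr => k _; rewrite !mxE mulrBr mulrN summxE -big_distrr /=.
  by congr (_ - _ * _); apply: eq_bigr => j _; rewrite !mxE.
rewrite sumrB sumrN; congr (_ - _); rewrite exchange_big /=; apply: eq_bigr => j _.
rewrite -pairing_limit_ray_true /pairing big_distrr; apply: eq_bigr => k _ /=; ring.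
Qed.

Definition eta_sum (i : 'I_r) : int := \sum_(j < r | (i < j)%N) b i j.

Lemma eta_sum_minus i : #|eta_plus b i| = 0%N ->
  (forall j, (i < j)%N -> b i j <= 0) /\ eta_sum i = \sum_(j in eta_minus b i) b i j.
Proof.
move=> /eqP; rewrite cards_eq0 => /eqP e0.
have b0 j : (i < j)%N -> b i j <= 0.
  move=> ij; rewrite leNgt; apply/negP => bij.
  by have := finset.in_set0 j; rewrite -e0 inE ij bij.
split=> //; rewrite /eta_sum (bigID (fun j => b i j < 0)) /= [X in _ + X]big1 ?addr0.
  by apply: eq_bigl => j; rewrite inE.
by move=> j /andP[ij]; rewrite -leNgt => b1; apply/eqP; rewrite eq_le b0.
Qed.

Lemma cond_N1_sum i : cond_N1 b i -> (forall j, (i < j)%N -> b i j <= 0) /\ -1 <= eta_sum i.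
Proof.
move=> [/eta_sum_minus[b0 ->] c1 cl]; split=> //.
case E: #|eta_minus b i| c1 => [|[|//]] _.
  by rewrite big1 // => j; rewrite (cards0_eq E) inE.
have /cards1P[l El] : #|eta_minus b i| == 1%N by rewrite E.
by rewrite El big_set1 cl.
Qed.

(** The negative entries are none, a single -1 or -2, or two entries -1. Only the signs and this
    bound on the sum matter afterwards. *)
Lemma cond_N2_sum i : cond_N2 b i -> (forall j, (i < j)%N -> b i j <= 0) /\ -2 <= eta_sum i.
Proof.
move=> [/eta_sum_minus[b0 ->] c2 cl cll]; split=> //.
case E: #|eta_minus b i| c2 => [|[|[|//]]] _.
- by rewrite big1 // => j; rewrite (cards0_eq E) inE.
- have /cards1P[l El] : #|eta_minus b i| == 1%N by rewrite E.
  by rewrite El big_set1; case: (cl l El) => ->.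
- have /cards2P[l1 [l2 [ne El]]] : #|eta_minus b i| == 2%N by rewrite E.
  have [e1 e2] := cll l1 l2 ne El.
  by rewrite El big_setU1 ?inE //= big_set1 e1 e2.
Qed.

(** The pairings with e_i^+ and e_i^- add up to - sum_(j > i) b_ij m_j, which is at least
    [eta_sum i] because b_ij <= 0 and m_j >= -1. One of the two is -1, which bounds the other. [N] =
    1 serves nefness and [N] = 0 ampleness. *)
Lemma vertex_opposite eps i (N : int) : N <= 1 ->
  (forall j, (i < j)%N -> -1 <= vertex b eps ord0 j) ->
  (forall j, (i < j)%N -> b i j <= 0) -> - N - 1 <= eta_sum i ->
  - N <= pairing (vertex b eps) (limit_ray b (~~ eps i, i)).
Proof.
move=> N1 v1 b0 bN; set m := vertex b eps.
have s : eta_sum i <= - \sum_(j < r | (i < j)%N) b i j * m ord0 j.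
  rewrite -sumrN; apply: ler_sum => j ij; rewrite -mulrN -[X in X <= _]mulr1.
  by apply: ler_wnM2l; [exact: b0|rewrite lerNl; exact: v1].
have : ex b eps m i = -1 := ex_vertex b eps i.
rewrite -pairing_ray; case: (eps i) => /=;
  rewrite !(pairing_limit_ray_true, pairing_limit_ray_false) => e.
  rewrite e opprK; move: bN s; set u := \sum_(_ < _ | _) _; lia.
move: bN s e; set u := \sum_(_ < _ | _) _; lia.
Qed.

Lemma vertex_admissible eps :
  (forall i, (forall j, (i < j)%N -> b i j <= 0) /\ -2 <= eta_sum i) ->
  admissible b 1 (vertex b eps).
Proof.
move=> bP.
have step i : (forall j, (i < j)%N -> -1 <= vertex b eps ord0 j) ->
    forall e, -1 <= pairing (vertex b eps) (limit_ray b (e, i)).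
  move=> v1 e; have [->|ne] := eqVneq e (eps i); first by rewrite pairing_ray ex_vertex.
  have -> : e = ~~ eps i by case: e (eps i) ne => [] [].
  by have [b0 b2] := bP i; exact: (vertex_opposite (N := 1)).
(* Descending induction on i, run on a bound [n] for r - i. *)
have v1 n (i : 'I_r) : (r - i <= n)%N -> -1 <= vertex b eps ord0 i.
  elim: n i => [|n IH] i; first by rewrite leqn0 subn_eq0 leqNgt ltn_ord.
  move=> hn; rewrite -pairing_limit_ray_true; apply: step => j ij; apply: IH.
  by move: hn ij; have := ltn_ord j; lia.
by move=> [e i]; apply: step => j _; exact: (v1 r _ (leq_subr _ _)).
Qed.

End Combinatorics.

(** * Bigness *)

(** In characteristic 0 the elements 0, 1, 2, ... are distinct, so a nonzero polynomial would have
    too many roots. *)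
Lemma horner_inj0 (K : numFieldType) (P : {poly K}) : (forall t, P.[t] = 0) -> P = 0.
Proof.
move=> P0; apply: (@roots_geq_poly_eq0 _ P [seq i%:R | i <- iota 0 (size P)]).
- by apply/allP => t _; apply/eqP.
- rewrite map_inj_uniq ?iota_uniq // => i j /eqP; rewrite eqr_nat => /eqP //.
- by rewrite size_map size_iota.
Qed.

(* A tensor power of a Vandermonde matrix is invertible. *)
Lemma monomials_free (K : fieldType) (r n : nat) (z : 'I_n -> K)
    (c : {ffun 'I_r -> 'I_n} -> K) : injective z ->
    (forall l : {ffun 'I_r -> 'I_n}, \sum_a c a * \prod_j z (l j) ^+ a j = 0) ->
  forall a, c a = 0.
Proof.
move=> zI c0 a; pose V := Vandermonde n (\row_j z j).
have Vu : V \in unitmx.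
  rewrite unitmxE det_Vandermonde unitfE; apply/prodf_neq0 => i _.
  apply/prodf_neq0 => j ij; rewrite !mxE subr_eq0.
  by apply: contraTneq ij => /zI ->; rewrite ltnn.
pose W := invmx V.
have VW (i k : 'I_n) : \sum_l z l ^+ i * W l k = (i == k)%:R.
  have /matrixP/(_ i k) := mulmxV Vu; rewrite !mxE => <-.
  by apply: eq_bigr => l _; rewrite !mxE.
transitivity (\sum_(l : {ffun 'I_r -> 'I_n}) \prod_j W (l j) (a j)
    * \sum_a' c a' * \prod_j z (l j) ^+ a' j); last first.
  by apply: big1 => l _; rewrite c0 mulr0.
under eq_bigr do rewrite big_distrr; rewrite exchange_big /=.
have -> : c a = \sum_a' c a' * (a' == a)%:R.
  by rewrite (bigD1 a) //= eqxx mulr1 big1 ?addr0 // => a' /negPf ->; rewrite mulr0.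
apply: eq_bigr => a' _.
under [RHS]eq_bigr do rewrite mulrCA -big_split.
rewrite -big_distrr /=; congr (_ * _).
rewrite -(bigA_distr_bigA (fun j l => W l (a j) * z l ^+ a' j)) /=.
have -> : \prod_j \sum_l W l (a j) * z l ^+ a' j = \prod_j (a' j == a j)%:R :> K.
  by apply: eq_bigr => j _; rewrite -VW; apply: eq_bigr => l _; rewrite mulrC.
have [->|ne] := eqVneq a' a; first by rewrite big1 // => j _; rewrite eqxx.
have /existsP[j aj] : [exists j, a' j != a j].
  apply: contraNT ne; rewrite negb_exists => /forallP e.
  by apply/eqP/ffunP => j; apply/eqP; have := e j; rewrite negbK.
by rewrite (bigD1 j) //= (negPf aj) mul0r.
Qed.

Section Bigness.
Variables (K : numFieldType) (r : nat) (b : 'I_r -> 'I_r -> int).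
Local Notation X := (toric_variety K (limit_fan b)).
Local Notation L := (anticanonical_bundle X r).
Let inj0 := @horner_inj0 K.

(** A crude bound for the sum of absolute values of the entries of any ray; the successor keeps it
    positive, as it becomes a divisor. *)
Definition ray_bound : nat := (\sum_u \sum_i absz (limit_ray b u ord0 i)).+1.

Definition box_char n (a : {ffun 'I_r -> 'I_n}) : 'rV[int]_r := \row_j (a j : nat)%:Z.

Lemma box_admissible k n (a : {ffun 'I_r -> 'I_n.+1}) : (n * ray_bound <= k)%N ->
  admissible b k (box_char a).
Proof.
move=> nk u; rewrite lerNl /pairing -sumrN.
apply: (@le_trans _ _ (n * \sum_i absz (limit_ray b u ord0 i))%N%:Z); last first.
  rewrite lez_nat; apply: leq_trans nk; rewrite leq_mul2l; apply/orP; right.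
  by apply: leqW; rewrite (bigD1 u) //= leq_addr.
rewrite big_distrr /= (big_morph Posz PoszD erefl); apply: ler_sum => i _.
rewrite mxE; have := ltn_ord (a i); rewrite ltnS.
case: (limit_ray b u ord0 i) => v an; nia.
Qed.

(** In the frame of the chart of all e_i^+, evaluation on a grid of torus points turns a relation
    between sections into one between monomials. *)
Lemma box_sections_free k n (c : {ffun 'I_r -> 'I_n.+1} -> K) : (n * ray_bound <= k)%N ->
    (forall (t : coords X r) p, cdom t p ->
       \sum_a c a * char_section inj0 k (box_char a) t p = 0) ->
  forall a, c a = 0.
Proof.
(* Grid values start at 1 and not at 0, so that the common factor [D] below is nonzero. *)
move=> nk c0; pose z (l : 'I_n.+1) : K := (l.+1)%:R.
apply: (@monomials_free _ _ _ z) => [i j /eqP|l].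
  by rewrite eqr_nat eqSS => /eqP/val_inj.
pose T (i : 'I_r) := true; pose x : 'rV[K]_r := \row_j z (l j).
pose C := chart_coords b inj0 T; have xT := chart_dom_phi b T x.
pose D : K := (\det (rays b T))%:~R ^+ k * \prod_j z (l j) ^+ k.
have D0 : D != 0.
  rewrite mulf_neq0 ?expf_neq0 ?det_rays_neq0 //.
  by apply/prodf_neq0 => j _; rewrite expf_neq0 // pnatr_eq0.
apply: (mulfI D0); rewrite mulr0 -[RHS](c0 C _ xT) big_distrr.
apply: eq_bigr => a _.
suff -> : char_section inj0 k (box_char a) C (phi b T x) = D * \prod_j z (l j) ^+ a j.
  exact: mulrCA.
rewrite (char_sectionE inj0 (box_admissible a nk) (t := C) xT xT) /local_section.
rewrite (jacobian1 (toric_ringed K b) (x := C) xT) det1 mul1r -mulrA; congr (_ * _).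
rewrite -big_split; apply: eq_bigr => j _ /=.
rewrite /coord_fun phiK mxE -(pairing_ray b T) pairing_limit_ray_true mxE.
by rewrite -PoszD absz_nat -exprD addnC.
Qed.

Lemma toric_big : big r L.
Proof.
pose B := ray_bound; have B0 : 0 < B%:R :> rat by rewrite ltr0n.
(* For n = floor(k / B) the box {0, ..., n}^r supplies (n + 1)^r independent sections, and n + 1 > k
   / B gives at least (k / B)^r. *)
exists (B%:R^-1 ^+ r), 0%N; split=> [|k _]; first by rewrite exprn_gt0 ?invr_gt0.
pose n := (k %/ B)%N; have nk : (n * B <= k)%N by exact: leq_divM.
exists #|{ffun 'I_r -> 'I_n.+1}|; split.
  exists (fun i => char_section inj0 k (box_char (enum_val i))); split=> [i|c c0 i].
    exact: char_section_is_section (box_admissible _ nk).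
  rewrite -(enum_valK i); apply: (box_sections_free (c := fun a => c (enum_rank a)) nk).
  move=> t p tp; rewrite -[RHS](c0 t p tp).
  rewrite [RHS](reindex (@enum_rank _)) /=; last exact: onW_bij (enum_rank_bij _).
  by apply: eq_bigr => a _; rewrite enum_rankK.
rewrite card_ffun !card_ord natrX -exprMn lerXn2r ?nnegrE ?mulr_ge0 ?invr_ge0 ?ler0n //.
rewrite mulrC ler_pdivrMr // -natrM ler_nat ltnW // ltn_ceil //.
Qed.

End Bigness.

Theorem lemma6p7 (R : realType) (S : finType) (A : S -> S -> int)
    (hA : gen_cartan A) (r : nat) (w : r.-tuple S) :
  (condition_I A w -> fano (toric_limit R[i] A w) r) /\
  (condition_II A w -> weak_fano (toric_limit R[i] A w) r).
Proof.
pose K : numFieldType := R[i]; pose inj0 := @horner_inj0 K.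
have smoothY := @toric_smooth K r (beta A w) inj0.
rewrite /toric_limit; split=> cond; split=> //.
- apply: (@toric_ample K r (beta A w) inj0) => eps i.
  (* The bound -1 of condition I implies the bound -2; admissibility supplies the inequalities m_j
     >= -1 required for the sharper estimate with [N] = 0. *)
  have am : admissible (beta A w) 1 (vertex (beta A w) eps).
    apply: vertex_admissible => k; have [? s] := cond_N1_sum (cond k).
    by split=> //; exact: le_trans s.
  have [b0 b1] := cond_N1_sum (cond i).
  apply: (vertex_opposite (N := 0)) => // j ij.
  by rewrite -(pairing_limit_ray_true (beta A w)); exact: am.
- apply: (@toric_nef K r (beta A w) inj0) => eps.
  by apply: vertex_admissible => i; exact: cond_N2_sum.
- exact: (@toric_big K).
Qed.
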